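(* Let $K$ be any constant and let $f\in\mathcal{S}_K$ be a gate as defined in the context. Then there exists a span program $P$ over $\mathbb{C}$ with $f_P=f$ whose witness size, computed with all input complexities $U_i=1$, satisfies $\mathrm{wsize}(P)=\mathrm{ADV}(f)$.
   Context: Gate set. $\mathcal{S}'_K$ consists of all Boolean functions on $1$, $2$ or $3$ bits and $\mathrm{EQUAL}_k$ for $2\le k\le K$, where $\mathrm{EQUAL}_k(y)=1$ iff all $y_r$ are equal. $\mathcal{S}_K$ consists of all functions $g\circ(h_1,\dots,h_\ell)$, where $g$ is a read-once formula of size at most $K$ over AND, OR, NOT, PARITY, and each $h_r$ is a single variable or a gate from $\mathcal{S}'_K$, the $h_r$ acting on pairwise disjoint variable sets. Span programs. A span program $P$ on $n$ variables consists of a target vector $t=(1,0,\dots,0)\in\mathbb{C}^m$ and vectors $v_j\in\mathbb{C}^m$ ($j\in J$), each labeled by a set $X_j$ of literals from $\{x_1,\overline{x_1},\dots,x_n,\overline{x_n}\}$. Grouped input $j$ is true on $x$ iff all literals of $X_j$ are true on $x$. We set $f_P(x)=1$ iff $t$ is a linear combination of the $v_j$ with $j$ true. Witness size. Let $I_j$ index the literals of $X_j$, and assign an input complexity $U_i>0$ to each $i\in I_j$. For input $x$, define the grouped input complexity $$\tilde U_j=\max\{\textstyle\sum_{i\in I_j}U_i,\,1\}\ \text{if $j$ is true},\qquad \tilde U_j=\Big(\sum_{i\in I_j,\ \text{literal $i$ false}}U_i^{-1}\Big)^{-1}\ \text{otherwise}.$$ Let $\tilde U=\sum_j\tilde U_j|j\rangle\langle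 j|$, let $\Pi=\sum_{j\text{ true}}|j\rangle\langle j|$, and let $A=\sum_j|v_j\rangle\langle j|$. - If $f_P(x)=1$: $\mathrm{wsize}(P,x)=\min\{\|\tilde U^{1/2}w\|^2: w\in\mathbb{C}^J,\ A\Pi w=t\}$. - If $f_P(x)=0$: $\mathrm{wsize}(P,x)=\min\{\|\tilde U^{1/2}A^\dagger w'\|^2: w'\in\mathbb{C}^m,\ \langle t|w'\rangle=1,\ \Pi A^\dagger w'=0\}$. Finally $\mathrm{wsize}(P)=\max_x\mathrm{wsize}(P,x)$. Adversary bound. For $f:\{0,1\}^k\to\{0,1\}$, $\mathrm{ADV}(f)=\max_\Gamma\|\Gamma\|/\max_i\|\Gamma\circ D_i\|$. The maximum is over nonzero symmetric nonnegative $2^k\times2^k$ matrices $\Gamma$ with $\Gamma[x,y]=0$ when $f(x)=f(y)$, and $D_i[x,y]=1$ iff $x_i\ne y_i$ (else $0$).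
   Formalization: The gate f is additionally assumed non-constant, because for a constant f there is no nonzero admissible Γ and ADV(f) is a maximum over the empty set, hence undefined. *)

(* Defs.v *)
From HB Require Import structures.
From mathcomp Require Import all_boot all_order all_algebra.
From mathcomp Require Import complex.
From mathcomp Require Import boolp classical_sets reals.
Set Implicit Arguments. Unset Strict Implicit. Unset Printing Implicit Defensive.
Import Order.TTheory GRing.Theory Num.Theory.
Local Open Scope ring_scope.

Notation input n := {ffun 'I_n -> bool}.

Definition depends_only_on n (A : {set 'I_n}) (h : input n -> bool) : Prop :=
  forall x y : input n, (forall i, i \in A -> x i = y i) -> h x = h y.

Definition gate_S' (K n : nat) (A : {set 'I_n}) (h : input n -> bool) : Prop :=
  depends_only_on A h /\
  ( (1 <= #|A| <= 3)%N
    \/ ((2 <= #|A| <= K)%N /\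
        forall x : input n, h x = [forall i in A, forall j in A, x i == x j]) ).

Inductive formula : Type :=
  | FLeaf of nat
  | FNot of formula
  | FAnd of formula & formula
  | FOr of formula & formula
  | FXor of formula & formula.

Fixpoint feval (g : formula) (y : nat -> bool) : bool :=
  match g with
  | FLeaf r => y r
  | FNot a => ~~ feval a y
  | FAnd a b => feval a y && feval b y
  | FOr a b => feval a y || feval b y
  | FXor a b => feval a y (+) feval b y
  end.

Fixpoint fleaves (g : formula) : seq nat :=
  match g with
  | FLeaf r => [:: r]
  | FNot a => fleaves a
  | FAnd a b | FOr a b | FXor a b => fleaves a ++ fleaves b
  end.

Definition read_once (g : formula) (l : nat) : bool := perm_eq (fleaves g) (iota 0 l).

Definition fsize (g : formula) : nat := size (fleaves g).

(** f belongs to S_K : f = g o (h_0, ..., h_{l-1}) with g read-once of size <= K,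
    each h_r a gate of S'_K (single variables are 1-bit functions) acting on the
    variable set A r, the sets A r pairwise disjoint and covering all variables. *)
Definition in_S (K n : nat) (f : input n -> bool) : Prop :=
  exists (l : nat) (g : formula) (A : nat -> {set 'I_n}) (h : nat -> input n -> bool),
    [/\ read_once g l /\ (fsize g <= K)%N,
        (forall r, (r < l)%N -> gate_S' K (A r) (h r)),
        (forall r r', (r < l)%N -> (r' < l)%N -> r != r' -> [disjoint A r & A r']),
        (forall i : 'I_n, exists2 r, (r < l)%N & i \in A r)
      & forall x : input n, f x = feval g (fun r => h r x)].

Section SpanPrograms.
Unset Implicit Arguments.
Variable R : realType.
Local Notation C := R[i].

(** Target t = e_0 in C^(m.+1) (the dimension is positive since t <> 0);
    vectors v_j, j in 'I_d, each labeled by a set X_j of literals (i, b), where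
    (i, true) is x_i and (i, false) is the negation of x_i. *)
Record spanprog (n : nat) := SpanProg {
  sp_m : nat;
  sp_d : nat;
  sp_v : 'I_sp_d -> 'I_sp_m.+1 -> C;
  sp_X : 'I_sp_d -> {set 'I_n * bool} }.
Arguments sp_m {n} s.
Arguments sp_d {n} s.
Arguments sp_v {n} s _ _.
Arguments sp_X {n} s _.

Definition target {m : nat} (k : 'I_m.+1) : C := if k == ord0 then 1 else 0.

Definition lit_true {n} (x : input n) (l : 'I_n * bool) : bool := x l.1 == l.2.

Definition grp_true {n} (P : spanprog n) (x : input n) (j : 'I_(sp_d P)) : bool :=
  [forall l in sp_X P j, lit_true x l].

Definition fP {n} (P : spanprog n) (x : input n) : Prop :=
  exists w : 'I_(sp_d P) -> C,
    forall k, \sum_(j | grp_true P x j) w j * sp_v P j k = target k.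

Definition sqmod (z : C) : R := complex.Re z ^+ 2 + complex.Im z ^+ 2.

(** Grouped input complexity, given input complexities U j l > 0 for l in X_j. *)
Definition Ugrp {n} (P : spanprog n) (U : 'I_(sp_d P) -> 'I_n * bool -> R)
    (x : input n) (j : 'I_(sp_d P)) : R :=
  if grp_true P x j then Num.max (\sum_(l in sp_X P j) U j l) 1
  else (\sum_(l in sp_X P j | ~~ lit_true x l) (U j l)^-1)^-1.

Definition Adag {n} (P : spanprog n) (w' : 'I_(sp_m P).+1 -> C) (j : 'I_(sp_d P)) : C :=
  \sum_k (sp_v P j k)^* * w' k.

Definition wsize_pos {n} (P : spanprog n) (U : 'I_(sp_d P) -> 'I_n * bool -> R) (x : input n) : R :=
  inf [set c | exists w : 'I_(sp_d P) -> C,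
     (forall k, \sum_(j | grp_true P x j) w j * sp_v P j k = target k) /\
     c = \sum_j Ugrp P U x j * sqmod (w j)].

Definition wsize_neg {n} (P : spanprog n) (U : 'I_(sp_d P) -> 'I_n * bool -> R) (x : input n) : R :=
  inf [set c | exists w' : 'I_(sp_m P).+1 -> C,
     [/\ w' ord0 = 1,   (* <t|w'> = 1 *)
         (forall j, grp_true P x j -> Adag P w' j = 0)   (* Pi A^dag w' = 0 *)
       & c = \sum_j Ugrp P U x j * sqmod (Adag P w' j)]].

Definition wsize_x {n} (P : spanprog n) (U : 'I_(sp_d P) -> 'I_n * bool -> R) (x : input n) : R :=
  if `[< fP P x >] then wsize_pos P U x else wsize_neg P U x.

Definition wsize {n} (P : spanprog n) (U : 'I_(sp_d P) -> 'I_n * bool -> R) : R :=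
  \big[Num.max/0]_(x : input n) wsize_x P U x.

Definition opnorm {n} (M : input n -> input n -> R) : R :=
  sup [set c | exists v : input n -> R,
     \sum_y v y ^+ 2 <= 1 /\
     c = Num.sqrt (\sum_x (\sum_y M x y * v y) ^+ 2)].

Definition Dmask {n} (i : 'I_n) (M : input n -> input n -> R) : input n -> input n -> R :=
  fun x y => if x i != y i then M x y else 0.

Definition adv_matrix {n} (f : input n -> bool) (G : input n -> input n -> R) : Prop :=
  [/\ exists x y, G x y != 0,
      forall x y, G x y = G y x,
      forall x y, 0 <= G x y
    & forall x y, f x = f y -> G x y = 0].

Definition ADV {n} (f : input n -> bool) : R :=
  sup [set c | exists G, adv_matrix f G /\
     c = opnorm G / \big[Num.max/0]_(i < n) opnorm (Dmask i G)].

End SpanPrograms.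

(* Main.v *)
Require Import Defs.
From HB Require Import structures.
From mathcomp Require Import all_boot all_order all_algebra.
From mathcomp Require Import complex.
From mathcomp Require Import boolp classical_sets reals.
From mathcomp Require Import ring lra.

(** By duality, the witness size of a span program is governed by vectors [u x i]
    with [sum_(i | x i != y i) <u x i, u y i> = 1] whenever [f x != f y], at cost
    [max_x sum_i |u x i|^2].  The witnesses of a span program for [f] form such
    vectors, and conversely such vectors give a span program of the same cost;
    moreover their cost bounds every adversary ratio.  Hence it suffices to
    exhibit, for each gate, vectors and a nonnegative adversary matrix with the
    same value [W].  Such pairs compose: for AND the values [a] and [b] give
    [sqrt (a^2 + b^2)], for XOR they give [a + b], with adversary matrix
    [G_a (x) I + I (x) G_b] restricted to the pairs on which the gate differs.
    Up to permutations and negations, the three-bit functions that are not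
    read-once are majority, multiplexer, exactly-two-of-three, equality and
    [~x1 ~x2 \/ x1 x2 x3], of values [2], [2], [sqrt 7], [3 / sqrt 2] and
    [sqrt (3 + sqrt 3)]; equality on [k] bits has value [k / sqrt (k - 1)]. *)

Local Open Scope ring_scope.
Set Implicit Arguments. Unset Strict Implicit. Unset Printing Implicit Defensive.
Import Order.TTheory GRing.Theory Num.Theory.

(** * Bilinear forms and operator norms *)

Section SquaredNorm.
Variables (R : realDomainType) (I : finType).
Implicit Types (M : I -> I -> R) (v w : I -> R).

Definition sqnorm v : R := \sum_x v x ^+ 2.

Definition mulmv M v (x : I) : R := \sum_y M x y * v y.

Definition bilin M w v : R := \sum_x w x * mulmv M v x.

Lemma sqnorm_ge0 v : 0 <= sqnorm v.
Proof. by apply: sumr_ge0 => x _; apply: sqr_ge0. Qed.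

Lemma sqnorm_eq0 v : sqnorm v = 0 -> forall x, v x = 0.
Proof.
move=> /eqP; rewrite psumr_eq0 => [/allP v0 x|x _]; last exact: sqr_ge0.
by apply/eqP; rewrite -sqrf_eq0; apply: v0; rewrite mem_index_enum.
Qed.

Lemma sqr_le_sqnorm v x : v x ^+ 2 <= sqnorm v.
Proof.
by rewrite /sqnorm (bigD1 x) //= lerDl sumr_ge0 // => y _; apply: sqr_ge0.
Qed.

Lemma sqnorm0 : sqnorm (fun=> 0) = 0.
Proof. by apply: big1 => x _; rewrite expr0n. Qed.

Lemma sqnormZ a v : sqnorm (fun x => a * v x) = a ^+ 2 * sqnorm v.
Proof. by rewrite mulr_sumr; apply: eq_bigr => x _; rewrite exprMn. Qed.

Lemma mulmvZ M a v x : mulmv M (fun y => a * v y) x = a * mulmv M v x.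
Proof. by rewrite mulr_sumr; apply: eq_bigr => y _; rewrite mulrCA. Qed.

End SquaredNorm.

Section OperatorNorm.
Variables (R : realType) (n : nat).
Implicit Types (M : input n -> input n -> R) (v w : input n -> R).

Lemma opnorm_has_ubound M :
  has_ubound [set c | exists v, sqnorm v <= 1 /\ c = Num.sqrt (sqnorm (mulmv M v))].
Proof.
exists (Num.sqrt (sqnorm (fun x => \sum_y `|M x y|))) => _ [v [v_le1 ->]].
have v_y_le1 y : `|v y| <= 1.
  rewrite -[_ <= 1](expr_le1 (isT : (0 < 2)%N)) // real_normK ?num_real //.
  exact: le_trans (sqr_le_sqnorm v y) v_le1.
rewrite ler_wsqrtr // ler_sum // => x _.
rewrite -[leLHS](real_normK (num_real _)) ler_sqr ?nnegrE ?sumr_ge0 //.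
apply: le_trans (ler_norm_sum _ _ _) _; apply: ler_sum => y _.
by rewrite normrM ler_piMr.
Qed.

Lemma sqrt_mulmv_le_opnorm M v :
  sqnorm v <= 1 -> Num.sqrt (sqnorm (mulmv M v)) <= opnorm R M.
Proof. by move=> v_le1; apply: ub_le_sup; [exact: opnorm_has_ubound|exists v]. Qed.

Lemma opnorm_le M c :
  (forall v, sqnorm v <= 1 -> Num.sqrt (sqnorm (mulmv M v)) <= c) ->
  opnorm R M <= c.
Proof.
move=> M_le; apply: ge_sup; last by move=> _ [v [v_le1 ->]]; apply: M_le.
by exists (Num.sqrt (sqnorm (mulmv M (fun=> 0)))), (fun=> 0); rewrite -/(sqnorm _) sqnorm0.
Qed.

Lemma opnorm_ge0 M : 0 <= opnorm R M.
Proof.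
by apply: le_trans (@sqrt_mulmv_le_opnorm M (fun=> 0) _); rewrite ?sqrtr_ge0 ?sqnorm0.
Qed.

Lemma sqnorm_mulmv_le M v : sqnorm (mulmv M v) <= opnorm R M ^+ 2 * sqnorm v.
Proof.
have [v0|v_neq0] := eqVneq (sqnorm v) 0.
  suff -> : sqnorm (mulmv M v) = 0 by rewrite v0 mulr0.
  apply: big1 => x _; rewrite /mulmv big1 ?expr0n // => y _.
  by rewrite (sqnorm_eq0 v0) mulr0.
have v_gt0 : 0 < sqnorm v by rewrite lt_neqAle eq_sym v_neq0 sqnorm_ge0.
pose a := (Num.sqrt (sqnorm v))^-1.
have a2 : a ^+ 2 = (sqnorm v)^-1 by rewrite exprVn sqr_sqrtr ?sqnorm_ge0.
have := @sqrt_mulmv_le_opnorm M (fun x => a * v x).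
rewrite sqnormZ a2 mulVf // => /(_ (lexx _)) Mav.
rewrite mulrC -ler_pdivrMl // -a2 -sqnormZ.
have <- : sqnorm (mulmv M (fun x => a * v x)) = sqnorm (fun x => a * mulmv M v x).
  by apply: eq_bigr => x _; rewrite mulmvZ.
by rewrite -[leLHS]sqr_sqrtr ?sqnorm_ge0 // ler_sqr ?nnegrE ?sqrtr_ge0 ?opnorm_ge0.
Qed.

Lemma bilin_le_opnorm M w v :
  bilin M w v <= opnorm R M * ((sqnorm w + sqnorm v) / 2).
Proof.
have := sqnorm_mulmv_le M v; rewrite /bilin; set N := opnorm R M => Mv.
have [N0|N_neq0] := eqVneq N 0.
  rewrite N0 mul0r big1 // => x _.
  rewrite (@sqnorm_eq0 _ _ (mulmv M v)) ?mulr0 //.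
  by apply/eqP; rewrite eq_le sqnorm_ge0 (le_trans Mv) // N0 expr0n mul0r.
have N_gt0 : 0 < N by rewrite lt_neqAle eq_sym N_neq0 opnorm_ge0.
apply: (@le_trans _ _ ((N * sqnorm w + N^-1 * sqnorm (mulmv M v)) / 2)).
  rewrite !mulr_sumr -big_split mulr_suml ler_sum //= => x _.
  have -> : (N * w x ^+ 2 + N^-1 * mulmv M v x ^+ 2) / 2 =
      w x * mulmv M v x + N^-1 * (N * w x - mulmv M v x) ^+ 2 / 2 by field.
  by rewrite lerDl divr_ge0 // mulr_ge0 ?invr_ge0 ?sqr_ge0 // ltW.
have : N^-1 * sqnorm (mulmv M v) <= N * sqnorm v.
  by rewrite ler_pdivrMl // mulrA -expr2.
by lra.
Qed.

Lemma opnorm_le_bilin M c : 0 <= c ->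
  (forall w v, bilin M w v <= c * ((sqnorm w + sqnorm v) / 2)) -> opnorm R M <= c.
Proof.
move=> c_ge0 M_le; apply: opnorm_le => v v_le1.
set s := Num.sqrt _; have [-> //|s_neq0] := eqVneq s 0.
have s_gt0 : 0 < s by rewrite lt_neqAle eq_sym s_neq0 sqrtr_ge0.
have s2 : sqnorm (mulmv M v) = s ^+ 2 by rewrite sqr_sqrtr ?sqnorm_ge0.
have := M_le (fun x => s^-1 * mulmv M v x) v; rewrite sqnormZ s2 exprVn mulVf ?sqrf_eq0 //.
have -> : bilin M (fun x => s^-1 * mulmv M v x) v = s.
  rewrite /bilin; under eq_bigr => x _ do rewrite -mulrA -expr2.
  by rewrite -mulr_sumr -/(sqnorm _) s2 expr2 mulKf.
move=> /le_trans; apply; rewrite ler_piMr //.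
by move: v_le1; lra.
Qed.

Lemma schur_test M (p : input n -> R) :
  (forall x y, M x y = M y x) -> (forall x y, 0 <= M x y) ->
  (forall x, 0 < p x) -> (forall x, mulmv M p x <= p x) -> opnorm R M <= 1.
Proof.
move=> Msym M_ge0 p_gt0 Mp; apply: opnorm_le_bilin => // w v; rewrite mul1r.
pose half (z : input n -> R) x y := M x y * (z x ^+ 2 * (p y / p x)).
have half_le z : \sum_x \sum_y half z x y <= sqnorm z.
  apply: ler_sum => x _.
  have -> : \sum_y half z x y = z x ^+ 2 * (mulmv M p x / p x).
    by rewrite mulr_suml mulr_sumr; apply: eq_bigr => y _; rewrite /half; ring.
  by rewrite ler_piMr ?sqr_ge0 // ler_pdivrMr ?mul1r.
apply: (@le_trans _ _ ((\sum_x \sum_y half w x y + \sum_x \sum_y half v x y) / 2)).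
  rewrite [X in _ + X]exchange_big /= -big_split mulr_suml; apply: ler_sum => x _ /=.
  rewrite mulr_sumr -big_split mulr_suml; apply: ler_sum => y _ /=.
  rewrite /half (Msym y x).
  have -> : (M x y * (w x ^+ 2 * (p y / p x)) + M x y * (v y ^+ 2 * (p x / p y))) / 2 =
      w x * (M x y * v y) + M x y * (w x * p y - v y * p x) ^+ 2 / (2 * (p x * p y)).
    by field; rewrite !gt_eqF.
  rewrite lerDl divr_ge0 //; first by rewrite mulr_ge0 ?sqr_ge0.
  by rewrite !mulr_ge0 // ltW.
by rewrite ler_pM2r ?invr_gt0 // lerD.
Qed.

End OperatorNorm.

(** * Dual and primal certificates of the adversary bound *)

Section Certificates.
Variables (R : realFieldType) (n : nat).
Implicit Types (A : {set 'I_n}) (x y : input n) (f : input n -> bool) (W : R).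

Definition query_gram (T : finType) (u : input n -> 'I_n -> T -> R) x y : R :=
  \sum_i \sum_k (x i != y i)%:R * (u x i k * u y i k).

Definition query_cost (T : finType) (u : input n -> 'I_n -> T -> R) x : R :=
  \sum_i \sum_k u x i k ^+ 2.

Lemma query_gramC (T : finType) (u : input n -> 'I_n -> T -> R) x y :
  query_gram u x y = query_gram u y x.
Proof.
by do 2!apply: eq_bigr => ? _; rewrite eq_sym; congr (_ * _); rewrite mulrC.
Qed.

Definition dual_solution f W (T : finType) (u : input n -> 'I_n -> T -> R) : Prop :=
  (forall x y, f x != f y -> query_gram u x y = 1) /\
  (forall x, query_cost u x <= W).

Definition dual_cert f W : Prop :=
  exists (T : finType) (u : input n -> 'I_n -> T -> R), dual_solution f W u.

(* An adversary matrix [G] on the variables of [A] with eigenvector [d] for [W].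
   Through Schur's test, the vectors [p i] witness that every [Dmask i G] has
   norm at most 1. *)
Record primal_cert A f W (G : input n -> input n -> R) (d : input n -> R)
    (p : 'I_n -> input n -> R) : Prop := PrimalCert {
  primal_sym : forall x y, G x y = G y x;
  primal_ge0 : forall x y, 0 <= G x y;
  primal_eq0 : forall x y, f x = f y -> G x y = 0;
  primal_local : forall (x y : input n) i, i \notin A -> x i != y i -> G x y = 0;
  primal_vec_local : forall x y : input n, {in A, x =1 y} -> d x = d y;
  primal_vec_neq0 : forall b, exists2 x, f x = b & d x != 0;
  primal_eigen : forall x, \sum_y G x y * d y = W * d x;
  primal_schur_gt0 : forall i x, 0 < p i x;
  primal_schur : forall i (x : input n),
    \sum_(y : input n) (x i != y i)%:R * (G x y * p i y) <= p i x }.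

Definition certified A f W : Prop :=
  [/\ depends_only_on A f, 0 < W, dual_cert f W & exists G d p, primal_cert A f W G d p].

Lemma dual_solution_ge0 f W (T : finType) (u : input n -> 'I_n -> T -> R) :
  dual_solution f W u -> 0 <= W.
Proof.
move=> [_ /(_ [ffun=> true])]; apply: le_trans.
by do 2!apply: sumr_ge0 => ? _; apply: sqr_ge0.
Qed.

Lemma dual_solution_intro f W (T : finType) (u : input n -> 'I_n -> T -> R) :
  (forall x y, f x -> ~~ f y -> query_gram u x y = 1) ->
  (forall x, query_cost u x <= W) -> dual_solution f W u.
Proof.
move=> u_eq1 u_cost; split=> // x y; case fx: (f x); case fy: (f y) => // _.
  by rewrite u_eq1 // fy.
by rewrite query_gramC u_eq1 ?fx.
Qed.

End Certificates.

Section AdversaryBound.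
Variables (R : realType) (n : nat) (f : input n -> bool).
Implicit Types (A : {set 'I_n}) (W : R) (G : input n -> input n -> R).

Definition max_mask_norm G : R := \big[Num.max/0]_(i < n) opnorm R (Dmask R i G).

Lemma max_mask_norm_ge0 G : 0 <= max_mask_norm G.
Proof. exact: bigmax_ge_id. Qed.

Lemma bilin_dual_solution W (T : finType) (u : input n -> 'I_n -> T -> R) G w v :
  dual_solution f W u -> (forall x y, f x = f y -> G x y = 0) ->
  bilin G w v =
    \sum_i \sum_k bilin (Dmask R i G) (fun x => w x * u x i k) (fun y => v y * u y i k).
Proof.
move=> [u_eq1 _] Gf.
transitivity (\sum_x \sum_y \sum_i \sum_k
    w x * u x i k * (Dmask R i G x y * (v y * u y i k))).
  apply: eq_bigr => x _; rewrite mulr_sumr; apply: eq_bigr => y _.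
  have [/Gf Gxy|fxy] := eqVneq (f x) (f y).
    by rewrite Gxy !(mul0r, mulr0) big1 // => i _; rewrite big1 // => k _;
      rewrite /Dmask Gxy if_same mul0r mulr0.
  rewrite -[LHS]mulr1 -[in LHS](u_eq1 _ _ fxy) mulr_sumr; apply: eq_bigr => i _.
  rewrite mulr_sumr; apply: eq_bigr => k _; rewrite /Dmask.
  by case: (x i != y i) => /=; ring.
under eq_bigr do rewrite exchange_big.
rewrite exchange_big; apply: eq_bigr => i _.
under eq_bigr do rewrite exchange_big.
rewrite exchange_big; apply: eq_bigr => k _; apply: eq_bigr => x _.
by rewrite mulr_sumr.
Qed.

Lemma opnorm_le_dual_cert W G :
  dual_cert f W -> (forall x y, f x = f y -> G x y = 0) ->
  opnorm R G <= max_mask_norm G * W.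
Proof.
move=> [T [u fu]] Gf; have W_ge0 := dual_solution_ge0 fu; have [_ u_cost] := fu.
apply: opnorm_le_bilin => [|w v]; first by rewrite mulr_ge0 ?max_mask_norm_ge0.
rewrite (bilin_dual_solution w v fu Gf).
pose wt (z : input n -> R) i k := sqnorm (fun x => z x * u x i k).
have cost z : \sum_i \sum_k wt z i k <= W * sqnorm z.
  under eq_bigr do rewrite exchange_big.
  rewrite exchange_big mulr_sumr ler_sum // => x _ /=.
  under eq_bigr => i _ do under eq_bigr => k _ do rewrite exprMn.
  under eq_bigr => i _ do rewrite -mulr_sumr.
  by rewrite -mulr_sumr mulrC ler_wpM2r ?sqr_ge0 //; apply: u_cost.
apply: (@le_trans _ _ (\sum_i \sum_k max_mask_norm G * ((wt w i k + wt v i k) / 2))).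
  apply: ler_sum => i _; apply: ler_sum => k _.
  apply: le_trans (bilin_le_opnorm _ _ _) _.
  rewrite ler_wpM2r ?divr_ge0 ?addr_ge0 ?sqnorm_ge0 //.
  exact: (le_bigmax _ (fun i => opnorm R (Dmask R i G))).
under eq_bigr do rewrite -mulr_sumr -mulr_suml big_split.
rewrite -mulr_sumr -mulr_suml big_split /= -mulrA ler_wpM2l ?max_mask_norm_ge0 //.
by rewrite mulrA mulrDr ler_pM2r ?invr_gt0 // lerD.
Qed.

Lemma adv_ratio_le_dual_cert W G :
  dual_cert f W -> (forall x y, f x = f y -> G x y = 0) ->
  opnorm R G / max_mask_norm G <= W.
Proof.
move=> fW Gf; have [->|D_neq0] := eqVneq (max_mask_norm G) 0.
  by have [T [u fu]] := fW; rewrite invr0 mulr0 (dual_solution_ge0 fu).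
rewrite ler_pdivrMr; last by rewrite lt_neqAle eq_sym D_neq0 max_mask_norm_ge0.
by rewrite mulrC opnorm_le_dual_cert.
Qed.

Lemma ADV_le_dual_cert W : dual_cert f W -> ADV R f <= W.
Proof.
move=> fW; have [[c Sc]|no_adv] :=
  pselect (exists c, exists G, adv_matrix R f G /\ c = opnorm R G / max_mask_norm G).
  apply: ge_sup; first by exists c.
  by move=> _ [G [[_ _ _ Gf] ->]]; apply: adv_ratio_le_dual_cert.
rewrite /ADV sup_out; first by have [T [u fu]] := fW; rewrite (dual_solution_ge0 fu).
by move=> [[c Sc] _]; apply: no_adv; exists c.
Qed.

Lemma adv_matrix_primal_cert A W G d p :
  W != 0 -> primal_cert A f W G d p -> adv_matrix R f G.
Proof.
move=> W_neq0 [Gsym G_ge0 Gf _ _ dnz eig _ _]; split=> //.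
have [x _ dx] := dnz true; apply: contrapT => noG.
have : W * d x != 0 by rewrite mulf_neq0.
rewrite -eig big1 ?eqxx // => y _.
by have [->|Gxy] := eqVneq (G x y) 0; [rewrite mul0r|case: noG; exists x, y].
Qed.

Lemma le_opnorm_primal_cert A W G d p : primal_cert A f W G d p -> W <= opnorm R G.
Proof.
move=> [_ _ _ _ _ dnz eig _ _]; have [x _ dx] := dnz true.
have d_gt0 : 0 < sqnorm d.
  rewrite lt_neqAle eq_sym sqnorm_ge0 andbT; apply: contra dx => /eqP/sqnorm_eq0 ->.
  exact: eqxx.
have Gd : sqnorm (mulmv G d) = W ^+ 2 * sqnorm d.
  by rewrite -sqnormZ; apply: eq_bigr => y _; rewrite /mulmv eig.
have := sqnorm_mulmv_le G d; rewrite Gd ler_pM2r // => W2.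
have [/ltW W_le0|W_ge0] := ltP W 0; first exact: le_trans W_le0 (opnorm_ge0 G).
by rewrite -ler_sqr ?nnegrE ?opnorm_ge0.
Qed.

Lemma max_mask_norm_le1_primal_cert A W G d p :
  primal_cert A f W G d p -> max_mask_norm G <= 1.
Proof.
move=> [Gsym G_ge0 _ _ _ _ _ p_gt0 schur]; apply: bigmax_le => // i _.
apply: (@schur_test _ _ _ (p i)) => [x y|x y|//|x].
- by rewrite /Dmask eq_sym Gsym.
- by rewrite /Dmask; case: ifP.
apply: le_trans (schur i x); apply: ler_sum => y _; rewrite /Dmask.
by case: (x i != y i); rewrite ?mul1r ?mul0r.
Qed.

Lemma certified_ADV A W : certified A f W -> ADV R f = W.
Proof.
move=> [_ W_gt0 fW [G [d [p GP]]]]; apply/eqP; rewrite eq_le ADV_le_dual_cert //=.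
have Gf := primal_eq0 GP; have WG := le_opnorm_primal_cert GP.
apply: (@le_trans _ _ (opnorm R G / max_mask_norm G)).
  have D_gt0 : 0 < max_mask_norm G.
    rewrite lt_neqAle max_mask_norm_ge0 andbT; apply/eqP => D0.
    have := opnorm_le_dual_cert fW Gf; rewrite -D0 mul0r.
    by move=> /(le_trans WG); rewrite leNgt W_gt0.
  rewrite ler_pdivlMr //; apply: le_trans WG.
  by rewrite ler_piMr ?(ltW W_gt0) // (max_mask_norm_le1_primal_cert GP).
apply: ub_le_sup; last first.
  by exists G; split=> //; apply: adv_matrix_primal_cert GP; rewrite gt_eqF.
by exists W => _ [H [[_ _ _ Hf] ->]]; apply: adv_ratio_le_dual_cert.
Qed.

End AdversaryBound.

(** * Span programs *)

Section ComplexParts.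
Variable R : rcfType.
Implicit Types z t : R[i].

Definition complex_part (b : bool) z : R := if b then complex.Re z else complex.Im z.

Lemma Re_sum (I : finType) (P : pred I) (F : I -> R[i]) :
  complex.Re (\sum_(j | P j) F j) = \sum_(j | P j) complex.Re (F j).
Proof. by apply: (big_morph (@complex.Re R)) => // -[a b] [c d]. Qed.

Lemma Re_conjM z t : complex.Re (z^* * t) = \sum_b complex_part b z * complex_part b t.
Proof. by rewrite big_bool; case: z t => a b [c d] /=; rewrite mulNr opprK. Qed.

End ComplexParts.

Lemma sum_literals (n : nat) (x : input n) (V : nmodType) (F : 'I_n * bool -> V) :
  \sum_l F l = \sum_i (F (i, x i) + F (i, ~~ x i)).
Proof.
transitivity (\sum_i \sum_b F (i, b)); first by rewrite pair_bigA; apply: eq_bigr => -[].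
by apply: eq_bigr => i _; rewrite big_bool; case: (x i); rewrite // addrC.
Qed.

Section SpanProgramWitnesses.
Variables (R : realType) (n : nat) (P : spanprog R n).
Implicit Types (x y : input n) (j : 'I_(sp_d R n P)).
Local Notation C := R[i].
Local Notation X := (sp_X R n P).
Local Notation unit_cost := (fun _ _ => 1 : R).

Lemma sqmodE (z : C) : sqmod R z = \sum_b complex_part b z ^+ 2.
Proof. by rewrite big_bool. Qed.

Lemma sqmod_ge0 (z : C) : 0 <= sqmod R z.
Proof. by rewrite addr_ge0 ?sqr_ge0. Qed.

Definition true_lits x j := [set i | (i, x i) \in X j].
Definition false_lits x j := [set i | (i, ~~ x i) \in X j].

Lemma grp_trueE x j : grp_true R P x j = (#|false_lits x j| == 0)%N.
Proof.
rewrite cards_eq0; apply/forall_inP/eqP => [Xx|no_false [i b] Xl].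
  apply/finset.setP => i; rewrite !inE; apply/negP => /Xx.
  by rewrite /lit_true /=; case: (x i).
apply: contraT => xb; have /finset.setP/(_ i) := no_false; rewrite !inE.
have -> : ~~ x i = b by move: xb; rewrite /lit_true /=; case: (x i) b {Xl} => [] [].
by rewrite Xl.
Qed.

Lemma Ugrp_unit x j : Ugrp R P unit_cost x j =
  if grp_true R P x j then Num.max #|true_lits x j|%:R 1 else #|false_lits x j|%:R^-1.
Proof.
have count (A : {set 'I_n}) : \sum_i (i \in A)%:R = #|A|%:R :> R.
  by rewrite -sum1_card natr_sum [RHS]big_mkcond; apply: eq_bigr => i _; case: (i \in A).
rewrite /Ugrp; case: ifPn => [|_].
  rewrite grp_trueE cards_eq0 => /eqP/finset.setP no_false; congr (Num.max _ 1).
  rewrite big_mkcond (sum_literals x) -count; apply: eq_bigr => i _.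
  by have := no_false i; rewrite !inE => ->; rewrite addr0; case: ifP.
rewrite big_mkcond (sum_literals x) -count; congr (_^-1); apply: eq_bigr => i _.
rewrite /lit_true /= eqxx andbF add0r invr1 inE.
by case: (_ \in _); case: (x i).
Qed.

Lemma grp_true_set1 x j l : X j = [set l] -> grp_true R P x j = lit_true x l.
Proof.
move=> Xj; rewrite /grp_true Xj; apply/forall_inP/idP => [|xl k].
  by apply; rewrite inE.
by rewrite inE => /eqP ->.
Qed.

Lemma Ugrp_unit_set1 x j l : X j = [set l] -> Ugrp R P unit_cost x j = 1.
Proof.
move=> Xj; rewrite /Ugrp (grp_true_set1 x Xj) Xj.
case: ifPn => [_|xl]; first by rewrite big_set1 maxxx.
by rewrite (big_pred1 l) ?invr1 // => k; rewrite inE /=; case: eqP => //= ->.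
Qed.

Definition pos_witness x (w : 'I_(sp_d R n P) -> C) : Prop :=
  forall k, \sum_(j | grp_true R P x j) w j * sp_v R n P j k = target R k.

Definition neg_witness x (w : 'I_(sp_m R n P).+1 -> C) : Prop :=
  w ord0 = 1 /\ forall j, grp_true R P x j -> Adag R P w j = 0.

Definition witness_cost x (z : 'I_(sp_d R n P) -> C) : R :=
  \sum_j Ugrp R P unit_cost x j * sqmod R (z j).

Lemma pos_neg_witness_pairing x w (w' : 'I_(sp_m R n P).+1 -> C) :
  pos_witness x w -> w' ord0 = 1 ->
  \sum_(j | grp_true R P x j) (w j)^* * Adag R P w' j = 1.
Proof.
move=> wx w'0.
transitivity (\sum_k (\sum_(j | grp_true R P x j) w j * sp_v R n P j k)^* * w' k).
  rewrite /Adag; under eq_bigr => j _ do rewrite mulr_sumr.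
  rewrite exchange_big; apply: eq_bigr => k _ /=.
  by rewrite rmorph_sum mulr_suml; apply: eq_bigr => j _; rewrite rmorphM mulrA.
rewrite (bigD1 ord0) //= wx /target eqxx rmorph1 mul1r w'0 big1 ?addr0 // => k k0.
by rewrite wx /target (negbTE k0) rmorph0 mul0r.
Qed.

(* If the target is not in the row space of the available vectors, some column
   of the cokernel separates it from them. *)
Lemma exists_neg_witness x : ~ fP R P x -> exists w', neg_witness x w'.
Proof.
move=> Px; pose t : 'rV[C]_(sp_m R n P).+1 := \row_k target R k.
pose M : 'M[C]_(sp_d R n P, (sp_m R n P).+1) :=
  \matrix_(j, k) if grp_true R P x j then sp_v R n P j k else 0.
have : ~~ (t <= M)%MS.
  apply/submxP => -[w /rowP tE]; apply: Px; exists (w 0) => k.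
  have := tE k; rewrite !mxE => ->; rewrite big_mkcond; apply: eq_bigr => j _.
  by rewrite mxE; case: ifP; rewrite ?mulr0.
rewrite submxE => /eqP tM; have tE c : (t *m cokermx M) 0 c = cokermx M ord0 c.
  rewrite mxE (bigD1 ord0) //= mxE /target eqxx mul1r big1 ?addr0 // => k k0.
  by rewrite mxE /target (negbTE k0) mul0r.
have [c tc] : exists c, cokermx M ord0 c != 0.
  apply: contrapT => no_c; apply: tM; apply/rowP => c; rewrite tE [RHS]mxE.
  by apply/eqP; apply: contraT => tc; case: no_c; exists c.
pose z k := (cokermx M k c / cokermx M ord0 c)^*.
exists z; split=> [|j jx]; first by rewrite /z divff ?rmorph1.
have v_orth : \sum_k sp_v R n P j k * (cokermx M k c / cokermx M ord0 c) = 0.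
  have /matrixP/(_ j c) := mulmx_coker M; rewrite !mxE.
  under eq_bigr do rewrite mxE jx; move=> Mjc.
  by under eq_bigr do rewrite mulrA; rewrite -mulr_suml Mjc mul0r.
transitivity ((\sum_k sp_v R n P j k * (cokermx M k c / cokermx M ord0 c))^*).
  by rewrite rmorph_sum; apply: eq_bigr => k _; rewrite rmorphM.
by rewrite v_orth rmorph0.
Qed.

Lemma Ugrp_unit_ge0 x j : 0 <= Ugrp R P unit_cost x j.
Proof. by rewrite Ugrp_unit; case: ifP => _; rewrite ?invr_ge0 // le_max ler01 orbT. Qed.

Lemma witness_cost_ge0 x z : 0 <= witness_cost x z.
Proof. by apply: sumr_ge0 => j _; rewrite mulr_ge0 ?Ugrp_unit_ge0 ?sqmod_ge0. Qed.

Lemma wsize_x_le x : wsize_x R P unit_cost x <= wsize R P unit_cost.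
Proof. exact: (le_bigmax 0 (wsize_x R P unit_cost) x). Qed.

Lemma wsize_pos_le x w :
  pos_witness x w -> wsize_pos R P unit_cost x <= witness_cost x w.
Proof.
move=> wx; apply: ge_inf; last by exists w.
by exists 0 => _ [v [_ ->]]; apply: witness_cost_ge0.
Qed.

Lemma wsize_neg_le x w' :
  neg_witness x w' -> wsize_neg R P unit_cost x <= witness_cost x (Adag R P w').
Proof.
move=> [w'0 w'x]; apply: ge_inf; last by exists w'.
by exists 0 => _ [v [_ _ ->]]; apply: witness_cost_ge0.
Qed.

Lemma pos_witness_adherent x e : 0 < e -> fP R P x ->
  exists2 w, pos_witness x w & witness_cost x w <= wsize R P unit_cost + e.
Proof.
move=> e_gt0 Px; have [w0 w0_orth] := Px.
have [|_ [w [wx ->]] cost] := @inf_adherent R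
    [set c | exists w, pos_witness x w /\ c = witness_cost x w] e e_gt0.
  split; first by exists (witness_cost x w0), w0.
  by exists 0 => _ [w [_ ->]]; apply: witness_cost_ge0.
exists w => //; apply: le_trans (ltW cost) _; rewrite lerD2r.
by apply: le_trans (wsize_x_le x); rewrite /wsize_x asboolT.
Qed.

Lemma neg_witness_adherent x e : 0 < e -> ~ fP R P x ->
  exists2 w', neg_witness x w' &
    witness_cost x (Adag R P w') <= wsize R P unit_cost + e.
Proof.
move=> e_gt0 Px; have [w0 [w0_target w0_orth]] := exists_neg_witness Px.
have [|_ [w' [w'0 w'x ->]] cost] := @inf_adherent R [set c | exists w',
    [/\ w' ord0 = 1, (forall j, grp_true R P x j -> Adag R P w' j = 0)
      & c = witness_cost x (Adag R P w')]] e e_gt0.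
  split; first by exists (witness_cost x (Adag R P w0)), w0.
  by exists 0 => _ [w' [_ _ ->]]; apply: witness_cost_ge0.
exists w' => //; apply: le_trans (ltW cost) _; rewrite lerD2r.
by apply: le_trans (wsize_x_le x); rewrite /wsize_x asboolF.
Qed.

End SpanProgramWitnesses.

Section SpanProgramLowerBound.
Variables (R : realType) (n : nat) (P : spanprog R n) (f : input n -> bool).
Local Notation C := R[i].
Local Notation unit_cost := (fun _ _ => 1 : R).

(* A false grouped input spreads its amplitude evenly over its false literals. *)
Definition literal_weight (x : input n) (i : 'I_n) (j : 'I_(sp_d R n P)) : R :=
  if f x then (grp_true R P x j && (i \in true_lits x j))%:R
  else (i \in false_lits x j)%:R / #|false_lits x j|%:R.

Lemma sum_literal_weightM x y j : f x -> ~~ f y ->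
  \sum_i (x i != y i)%:R * (literal_weight x i j * literal_weight y i j) =
  (grp_true R P x j && ~~ grp_true R P y j)%:R.
Proof.
move=> fx fy; rewrite /literal_weight fx (negbTE fy).
have [xj|_] := boolP (grp_true R P x j); last first.
  by apply: big1 => i _; rewrite mul0r mulr0.
transitivity (\sum_i (i \in false_lits y j)%:R / #|false_lits y j|%:R : R).
  apply: eq_bigr => i _; rewrite andTb; have [iy|] := boolP (_ \in false_lits y j).
    have /forall_inP/(_ (i, ~~ y i)) := xj; rewrite inE in iy.
    by move=> /(_ iy)/eqP /= xi; rewrite inE xi iy; case: (y i); rewrite !mul1r.
  by rewrite !mul0r !mulr0.
rewrite -mulr_suml grp_trueE -natr_sum -big_mkcond sum1_card /=.
by case: eqP => [->|/eqP N0]; rewrite ?mul0r // mulfV // pnatr_eq0.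
Qed.

Lemma sum_sqr_literal_weight_le x j :
  \sum_i literal_weight x i j ^+ 2 <= Ugrp R P unit_cost x j.
Proof.
have bool2 (b : bool) : b%:R ^+ 2 = b%:R :> R by case: b; rewrite ?expr1n ?expr0n.
rewrite /literal_weight Ugrp_unit; case: (f x).
  case: ifP => _; last first.
    by rewrite big1 ?invr_ge0 // => i _; rewrite expr0n.
  under eq_bigr do rewrite bool2.
  by rewrite -natr_sum -big_mkcond sum1_card le_max lexx.
under eq_bigr do rewrite expr_div_n bool2.
rewrite -mulr_suml -natr_sum -big_mkcond sum1_card grp_trueE /=.
case: eqP => [->|/eqP N0]; first by rewrite mul0r le_max ler01 orbT.
by rewrite expr2 invfM mulrA mulfV ?mul1r // pnatr_eq0.
Qed.

Lemma dual_solution_witnesses (z : input n -> 'I_(sp_d R n P) -> C) W :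
  (forall x, f x -> pos_witness x (z x)) ->
  (forall y, ~~ f y -> exists2 w', neg_witness y w' & z y = Adag R P w') ->
  (forall x, witness_cost x (z x) <= W) ->
  dual_solution f W
    (fun x i (k : 'I_(sp_d R n P) * bool) =>
       literal_weight x i k.1 * complex_part k.2 (z x k.1)).
Proof.
move=> zpos zneg zW.
have sumk (F : 'I_(sp_d R n P) -> bool -> R) :
    \sum_k F k.1 k.2 = \sum_j \sum_b F j b by rewrite pair_bigA.
apply: dual_solution_intro => [x y fx fy|x]; last first.
  apply: le_trans (zW x); rewrite /query_cost exchange_big.
  rewrite (sumk (fun j b => \sum_i (literal_weight x i j * complex_part b (z x j)) ^+ 2)).
  apply: ler_sum => j _; rewrite sqmodE mulr_sumr; apply: ler_sum => b _.
  under eq_bigr do rewrite exprMn.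
  by rewrite -mulr_suml ler_wpM2r ?sqr_ge0 ?sum_sqr_literal_weight_le.
have [w' w'y zy] := zneg y fy.
transitivity (\sum_j (grp_true R P x j && ~~ grp_true R P y j)%:R *
    complex.Re ((z x j)^* * z y j)).
  rewrite /query_gram exchange_big (sumk (fun j b => \sum_i (x i != y i)%:R *
    (literal_weight x i j * complex_part b (z x j) *
     (literal_weight y i j * complex_part b (z y j))))).
  apply: eq_bigr => j _; rewrite -sum_literal_weightM // Re_conjM mulr_sumr.
  apply: eq_bigr => b _; rewrite mulr_suml; apply: eq_bigr => i _; ring.
rewrite -[RHS]/(complex.Re (1 : C)) -(pos_neg_witness_pairing (zpos x fx) (proj1 w'y)).
rewrite Re_sum [RHS]big_mkcond; apply: eq_bigr => j _; rewrite zy.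
case: (grp_true R P x j); last by rewrite mul0r.
by have [/(proj2 w'y) ->|_] := boolP (grp_true R P y j); rewrite ?mulr0 ?mul0r ?mul1r.
Qed.

Lemma ADV_le_wsize : (forall x, fP R P x <-> f x) -> ADV R f <= wsize R P unit_cost.
Proof.
move=> Pf; apply/ler_addgt0Pr => e e_gt0; apply: ADV_le_dual_cert.
have witness x : exists z : 'I_(sp_d R n P) -> C,
    (if f x then pos_witness x z else exists2 w', neg_witness x w' & z = Adag R P w') /\
    witness_cost x z <= wsize R P unit_cost + e.
  case: (boolP (f x)) => [/Pf Px|fx].
    by have [w wx cost] := pos_witness_adherent e_gt0 Px; exists w.
  have [|w' w'x cost] := neg_witness_adherent e_gt0 (x := x) (P := P).
    by move=> /Pf; apply/negP.
  by exists (Adag R P w'); split=> //; exists w'.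
have [z zP] := choice witness.
do 2!eexists; apply: (@dual_solution_witnesses z) => [x fx|y /negbTE fy|x].
- by have := zP x; rewrite fx => -[].
- by have := zP y; rewrite fy => -[].
- by have [] := zP x.
Qed.

End SpanProgramLowerBound.

Section DualProgram.
Variables (R : realType) (n : nat) (f : input n -> bool) (W : R).
Variables (T : finType) (u : input n -> 'I_n -> T -> R) (y0 : input n).
Hypotheses (fu : dual_solution f W u) (fy0 : ~~ f y0).
Implicit Types x y : input n.
Local Notation C := R[i].
Local Notation J := ('I_n * bool * T)%type.
Local Notation unit_cost := (fun _ _ => 1 : R).

Definition dual_entry (k : J) y : R := (y k.1.1 != k.1.2)%:R * u y k.1.1 k.2.

Definition false_row (r : 'I_#|input n|) : input n :=
  if f (enum_val r) then y0 else enum_val r.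

(* The rows of the natural program are indexed by the false inputs and its
   target is the all-one vector; subtracting row [y0] from the others brings
   the target to [(1, 0, ..., 0)]. *)
Definition dual_program : spanprog R n :=
  @SpanProg R n #|input n| #|{: J}|
    (fun j k => (match unlift ord0 k with
                 | None => dual_entry (enum_val j) y0
                 | Some r => dual_entry (enum_val j) (false_row r) -
                             dual_entry (enum_val j) y0
                 end)%:C%C)
    (fun j => [set (enum_val j).1]).
Local Notation P := dual_program.

Lemma grp_true_dual_program x (j : 'I_#|{: J}|) :
  grp_true R P x j = (x (enum_val j).1.1 == (enum_val j).1.2).
Proof. exact: grp_true_set1. Qed.

Lemma witness_cost_dual_program x (z : 'I_#|{: J}| -> C) :
  @witness_cost R n P x z = \sum_j sqmod R (z j).
Proof.
by apply: eq_bigr => j _; rewrite (@Ugrp_unit_set1 _ _ _ x j (enum_val j).1) ?mul1r.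
Qed.

Lemma sum_dual_program x (F : J -> R) : \sum_(j < #|{: J}|) F (enum_val j) =
  \sum_i \sum_k (F (i, x i, k) + F (i, ~~ x i, k)).
Proof.
rewrite -(big_enum_val (A := {: J}) F) /=.
transitivity (\sum_(l : 'I_n * bool) \sum_k F (l, k)).
  by rewrite pair_bigA; apply: eq_big => -[].
by rewrite (sum_literals x); apply: eq_bigr => i _; rewrite big_split.
Qed.

Definition dual_pos_witness x (j : 'I_#|{: J}|) : C :=
  ((x (enum_val j).1.1 == (enum_val j).1.2)%:R * u x (enum_val j).1.1 (enum_val j).2)%:C%C.

Definition dual_neg_witness y (k : 'I_#|input n|.+1) : C :=
  if unlift ord0 k is Some r then (enum_val r == y)%:R else 1.

Lemma sum_dual_pos_witnessM x y : f x -> ~~ f y ->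
  \sum_(j | grp_true R P x j) dual_pos_witness x j * (dual_entry (enum_val j) y)%:C%C = 1.
Proof.
move=> fx fy; have fxy : f x != f y by rewrite fx (negbTE fy).
pose F (k : J) := (x k.1.1 == k.1.2)%:R * u x k.1.1 k.2 * dual_entry k y.
transitivity ((\sum_(j < #|{: J}|) F (enum_val j))%:C%C : C).
  rewrite rmorph_sum big_mkcond; apply: eq_bigr => j _.
  rewrite grp_true_dual_program /F /dual_pos_witness.
  by case: (_ == _); rewrite ?rmorphM // !mul0r.
rewrite (sum_dual_program x) -[RHS]/(1%:C%C) -[in RHS](proj1 fu _ _ fxy); congr (_%:C%C).
apply: eq_bigr => i _; apply: eq_bigr => k _; rewrite /F /dual_entry /=.
by case: (x i); case: (y i) => /=; ring.
Qed.

Lemma pos_witness_dual_program x : f x -> @pos_witness R n P x (dual_pos_witness x).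
Proof.
move=> fx k; rewrite /target; case: (unliftP ord0 k) => [r ->|->].
  rewrite eq_sym (negbTE (neq_lift _ _)) /=.
  under eq_bigr => j _ do rewrite liftK rmorphB mulrBr.
  by rewrite sumrB !sum_dual_pos_witnessM ?subrr // /false_row; case: ifP => // ->.
rewrite eqxx /=; under eq_bigr => j _ do rewrite unlift_none.
exact: sum_dual_pos_witnessM.
Qed.

Lemma Adag_dual_neg_witness y j : ~~ f y ->
  Adag R P (dual_neg_witness y) j = (dual_entry (enum_val j) y)%:C%C.
Proof.
have conj_real (c : R) : (c%:C%C : C)^* = c%:C%C by exact: conjc_real.
move=> fy; rewrite /Adag big_ord_recl /= /dual_neg_witness unlift_none conj_real mulr1.
rewrite (bigD1 (enum_rank y)) //= liftK enum_rankK eqxx conj_real mulr1 big1 => [|r ry].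
  by rewrite addr0 /false_row enum_rankK (negbTE fy) -rmorphD addrC subrK.
rewrite liftK; case: eqP => [rE|]; rewrite ?mulr0 //.
by rewrite -rE enum_valK eqxx in ry.
Qed.

Lemma neg_witness_dual_program y : ~~ f y -> @neg_witness R n P y (dual_neg_witness y).
Proof.
move=> fy; split=> [|j]; first by rewrite /dual_neg_witness unlift_none.
rewrite grp_true_dual_program Adag_dual_neg_witness // => /eqP yj.
by rewrite /dual_entry yj eqxx mul0r.
Qed.

Lemma dual_program_fP x : fP R P x <-> f x.
Proof.
split=> [[w wx]|/pos_witness_dual_program wx]; last by exists (dual_pos_witness x).
apply/negPn/negP => /neg_witness_dual_program[w0 w1].
have := pos_neg_witness_pairing wx w0; rewrite big1 => [/esym/eqP|j jx].
  by rewrite oner_eq0.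
by rewrite w1 ?mulr0.
Qed.

Lemma wsize_dual_program_le : wsize R P unit_cost <= W.
Proof.
have sqmod_real (c : R) : sqmod R c%:C%C = c ^+ 2 by rewrite /sqmod /= expr0n addr0.
have u_cost := proj2 fu; apply: bigmax_le => [|x _]; first exact: dual_solution_ge0 fu.
rewrite /wsize_x; case: asboolP => [/dual_program_fP fx|/dual_program_fP/negP fx].
  apply: le_trans (wsize_pos_le (pos_witness_dual_program fx)) _.
  rewrite witness_cost_dual_program; apply: le_trans (u_cost x).
  under eq_bigr do rewrite sqmod_real.
  rewrite (sum_dual_program x (fun k => ((x k.1.1 == k.1.2)%:R * u x k.1.1 k.2) ^+ 2)).
  apply: ler_sum => i _; apply: ler_sum => k _ /=.
  by case: (x i); rewrite /= mul1r mul0r expr0n addr0.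
apply: le_trans (wsize_neg_le (neg_witness_dual_program fx)) _.
rewrite witness_cost_dual_program; apply: le_trans (u_cost x).
under eq_bigr do rewrite Adag_dual_neg_witness // sqmod_real.
rewrite (sum_dual_program x (fun k => dual_entry k x ^+ 2)).
apply: ler_sum => i _; apply: ler_sum => k _; rewrite /dual_entry /=.
by case: (x i); rewrite /= mul1r mul0r expr0n add0r.
Qed.

End DualProgram.

(** * Relabelling variables *)

Section Relabelling.
Variables (R : realFieldType) (n k : nat) (v : 'I_k -> 'I_n) (s : input k) (o : bool).
Hypothesis v_inj : injective v.
Implicit Types (x y : input n) (z : input k) (A : {set 'I_k}).
Implicit Types (f : input k -> bool) (W : R).

Definition relabel x : input k := [ffun j => s j (+) x (v j)].

Definition unrelabel x z : input n :=
  [ffun i => if [pick j | v j == i] is Some j then s j (+) z j else x i].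

Definition same_off_codom x y : bool := [forall i, (i \notin codom v) ==> (x i == y i)].

Lemma relabel_eq x y j : (relabel x j == relabel y j) = (x (v j) == y (v j)).
Proof. by rewrite !ffunE (inj_eq (@addbI _)). Qed.

Lemma pick_codom j : [pick j' | v j' == v j] = Some j.
Proof. by case: pickP => [j' /eqP/v_inj ->|/(_ j)]; rewrite ?eqxx. Qed.

Lemma relabelK x : cancel (unrelabel x) relabel.
Proof. by move=> z; apply/ffunP => j; rewrite !ffunE pick_codom addKb. Qed.

Lemma same_off_unrelabel x z : same_off_codom x (unrelabel x z).
Proof.
apply/forall_inP => i /codomP vi; rewrite ffunE.
by case: pickP => [j /eqP ji|//]; case: vi; exists j.
Qed.

Lemma unrelabelK x y : same_off_codom x y -> unrelabel x (relabel y) = y.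
Proof.
move=> /forall_inP xy; apply/ffunP => i; rewrite ffunE.
case: pickP => [j /eqP <-|vi]; first by rewrite ffunE addKb.
by apply/eqP; apply: xy; apply/codomP => -[j ij]; have := vi j; rewrite ij eqxx.
Qed.

Lemma sum_relabel x (F : input k -> R) :
  \sum_(y | same_off_codom x y) F (relabel y) = \sum_z F z.
Proof.
rewrite (reindex_onto (unrelabel x) relabel) => [|y]; last exact: unrelabelK.
by apply: eq_big => z; rewrite relabelK ?same_off_unrelabel ?eqxx.
Qed.

Lemma dual_cert_relabel f W : dual_cert f W -> dual_cert (fun x => o (+) f (relabel x)) W.
Proof.
move=> [T [u [u_eq1 u_cost]]].
have sumv (F : 'I_k -> T -> R) :
    \sum_i \sum_(t : 'I_k * T) (v t.1 == i)%:R * F t.1 t.2 = \sum_j \sum_t F j t.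
  rewrite exchange_big [RHS]pair_bigA; apply: eq_bigr => t _ /=.
  rewrite (bigD1 (v t.1)) //= eqxx mul1r big1 ?addr0 // => i /negbTE.
  by rewrite eq_sym => ->; rewrite mul0r.
exists ('I_k * T)%type, (fun x i t => (v t.1 == i)%:R * u (relabel x) t.1 t.2).
split=> [x y fxy|x].
  have {}fxy : f (relabel x) != f (relabel y) by apply: contra fxy => /eqP ->.
  rewrite -[RHS](u_eq1 _ _ fxy) /query_gram -sumv.
  apply: eq_bigr => i _; apply: eq_bigr => t _.
  by rewrite relabel_eq; case: (v _ =P i) => [->|_]; rewrite ?mul1r // !mul0r mulr0.
apply: le_trans (u_cost (relabel x)); rewrite /query_cost -[leRHS]sumv.
apply: ler_sum => i _; apply: ler_sum => t _.
by case: eqP => _; rewrite ?mul1r // !mul0r expr0n.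
Qed.

Definition relabel_matrix (G : input k -> input k -> R) x y : R :=
  (same_off_codom x y)%:R * G (relabel x) (relabel y).

Definition relabel_schur (p : 'I_k -> input k -> R) i x : R :=
  if [pick j | v j == i] is Some j then p j (relabel x) else 1.

Lemma sum_relabel_matrix G x (F : input k -> R) :
  \sum_y relabel_matrix G x y * F (relabel y) = \sum_z G (relabel x) z * F z.
Proof.
rewrite -(sum_relabel x) [RHS]big_mkcond; apply: eq_bigr => y _.
by rewrite /relabel_matrix; case: ifP; rewrite ?mul1r // !mul0r.
Qed.

Lemma relabel_matrix_off G i x y :
  i \notin codom v -> x i != y i -> relabel_matrix G x y = 0.
Proof.
move=> i_off xy; rewrite /relabel_matrix.
case: (boolP (same_off_codom x y)) => [/forall_inP/(_ i i_off)|_]; last by rewrite mul0r.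
by rewrite (negbTE xy).
Qed.

Lemma relabel_schur_le A f W G d p i x : primal_cert A f W G d p ->
  \sum_(y : input n) (x i != y i)%:R * (relabel_matrix G x y * relabel_schur p i y) <=
  relabel_schur p i x.
Proof.
move=> GP; rewrite /relabel_schur; case: pickP => [j /eqP ji|i_off].
  apply: le_trans (primal_schur GP j (relabel x)).
  under [leRHS]eq_bigr do rewrite mulrCA.
  by rewrite -sum_relabel_matrix ler_sum // => y _; rewrite relabel_eq ji mulrCA.
rewrite big1 // => y _; have [_|xy] := eqVneq (x i) (y i); first by rewrite mul0r.
rewrite (relabel_matrix_off _ _ xy) ?mul0r ?mulr0 //.
by apply/codomP => -[j ij]; have := i_off j; rewrite ij eqxx.
Qed.

Lemma primal_cert_relabel A f W G d p : primal_cert A f W G d p ->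
  primal_cert (v @: A) (fun x => o (+) f (relabel x)) W
    (relabel_matrix G) (fun x => d (relabel x)) (relabel_schur p).
Proof.
move=> GP; have [Gsym G_ge0 Gf GA dA dnz eig p_gt0 _] := GP.
split=> [x y|x y|x y /addbI|x y i iA xy|x y xy|b|x|i x|i x].
- rewrite /relabel_matrix Gsym; congr (_%:R * _); congr nat_of_bool.
  by apply: eq_forallb => i; rewrite [x i == _]eq_sym.
- by rewrite mulr_ge0 ?ler0n.
- by rewrite /relabel_matrix => /Gf ->; rewrite mulr0.
- have [/codomP[j ij]|i_off] := boolP (i \in codom v); last exact: relabel_matrix_off xy.
  rewrite /relabel_matrix (GA _ _ j) ?mulr0 // ?relabel_eq -?ij //.
  by apply: contra iA => jA; rewrite ij; apply: imset_f.
- by apply: dA => j jA; rewrite !ffunE xy ?imset_f.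
- have [z fz dz] := dnz (o (+) b); exists (unrelabel [ffun=> true] z).
    by rewrite relabelK fz addKb.
  by rewrite relabelK.
- by rewrite sum_relabel_matrix eig.
- by rewrite /relabel_schur; case: pickP.
exact: relabel_schur_le GP.
Qed.

Lemma certified_relabel A f W : certified A f W ->
  certified (v @: A) (fun x => o (+) f (relabel x)) W.
Proof.
move=> [fA W_gt0 fW [G [d [p GP]]]]; split=> //.
- move=> x y xy; congr (_ (+) _); apply: fA => j jA.
  by rewrite !ffunE xy ?imset_f.
- exact: dual_cert_relabel.
by do 3!eexists; apply: primal_cert_relabel GP.
Qed.

End Relabelling.

Section BasicCertificates.
Variables (R : realFieldType) (n : nat).
Implicit Types (A B : {set 'I_n}) (f g : input n -> bool) (W : R).

Lemma eq_certified A f g W : f =1 g -> certified A f W -> certified A g W.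
Proof. by move=> /funext ->. Qed.

Lemma certified_sub A B f W : A \subset B -> certified A f W -> certified B f W.
Proof.
move=> /fintype.subsetP AB [fA W_gt0 fW].
move=> [G [d [p [Gsym G_ge0 Gf GA dA dnz eig p_gt0 schur]]]].
split=> // [x y xy|]; first by apply: fA => i /AB; apply: xy.
exists G, d, p; split=> // [x y i iB|x y xy].
  by apply: GA; apply: contra iB; apply: AB.
by apply: dA => i /AB; apply: xy.
Qed.

Lemma certified_not A f W : certified A f W -> certified A (fun x => ~~ f x) W.
Proof.
move=> /(certified_relabel [ffun=> false] true (@inj_id _)); rewrite imset_id.
apply: eq_certified => x; congr (~~ f _); apply/ffunP => i.
by rewrite !ffunE.
Qed.

(* When the edges flipping a given bit form a matching, all Schur vectors may
   be constant. *)
Lemma certified_matching f (E : rel (input n)) (d : input n -> R) W :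
  0 < W -> dual_cert f W -> symmetric E -> (forall x y, E x y -> f x != f y) ->
  (forall i x y z, E x y -> E x z -> x i != y i -> x i != z i -> y = z) ->
  (forall b, exists2 x, f x = b & d x != 0) ->
  (forall x, \sum_y (E x y)%:R * d y = W * d x) ->
  certified [set: 'I_n] f W.
Proof.
move=> W_gt0 fW Esym Ef Em dnz eig; split=> //.
  by move=> x y xy; congr f; apply/ffunP => i; apply: xy; rewrite inE.
exists (fun x y => (E x y)%:R), d, (fun _ _ => 1).
split=> // [x y|x y fxy|x y i|x y xy|i x].
- by rewrite Esym.
- by case: (boolP (E x y)) => // /Ef; rewrite fxy eqxx.
- by rewrite inE.
- by congr d; apply/ffunP => i; apply: xy; rewrite inE.
under eq_bigr do rewrite mulr1 -natrM mulnb.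
rewrite -natr_sum -big_mkcond sum1_card lern1.
apply/card_le1_eqP => y z; rewrite -!topredE /=.
by move=> /andP[xy Exy] /andP[xz Exz]; apply: Em Exz Exy xz xy.
Qed.

End BasicCertificates.

Lemma certified_var (R : realFieldType) (n : nat) (i : 'I_n) :
  certified [set i] (fun x => x i) (1 : R).
Proof.
pose negb1 (x : input 1) : input 1 := [ffun j => ~~ x j].
have negb1K : involutive negb1 by move=> x; apply/ffunP => j; rewrite !ffunE negbK.
have bit : certified [set: 'I_1] (fun x => x ord0) (1 : R).
  apply: (@certified_matching _ _ _ (fun x y => y == negb1 x) (fun=> 1)) => //.
  - exists unit, (fun _ _ _ => 1); split=> [x y xy|x].
      by rewrite /query_gram big_ord1 (big_pred1 tt) => [|[]//]; rewrite xy !mulr1.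
    by rewrite /query_cost big_ord1 (big_pred1 tt) => [|[]//]; rewrite expr1n.
  - by move=> x y; rewrite eq_sym (can2_eq negb1K negb1K).
  - by move=> x y /eqP ->; rewrite ffunE; case: (x ord0).
  - by move=> ? x y z /eqP -> /eqP ->.
  - by move=> b; exists [ffun=> b]; rewrite ?ffunE ?oner_neq0.
  move=> x; rewrite (bigD1 (negb1 x)) //= eqxx big1 ?addr0 // => y /negbTE ->.
  by rewrite mul0r.
have v_inj : injective (fun _ : 'I_1 => i) by move=> j l _; rewrite !ord1.
have := certified_relabel [ffun=> false] false v_inj bit.
have -> : [set i | _ in [set: 'I_1]] = [set i].
  apply/finset.setP => l; rewrite inE; apply/imsetP/eqP => [[] //|->].
  by exists ord0; rewrite ?inE.
by apply: eq_certified => x; rewrite !ffunE.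
Qed.

(** * Composition with a two-bit gate *)

Section EdgesAndTags.
Variables (R : realFieldType) (n : nat).
Implicit Types (A : {set 'I_n}) (f h : input n -> bool) (W : R).

(* For [f x != f y] the tags [h x == f x] and [h y == f y] agree exactly when
   [h x != h y], so that the pairs on which [h] does not change contribute 0. *)
Lemma dual_cert_tag f h W : dual_cert h W ->
  exists (T : finType) (u : input n -> 'I_n -> T -> R),
    (forall x y, f x != f y -> query_gram u x y = (h x != h y)%:R) /\
    (forall x, query_cost u x <= W).
Proof.
move=> [T [u [u_eq1 u_cost]]].
have sum_tag (F : T -> bool -> R) : \sum_k F k.1 k.2 = \sum_k (F k true + F k false).
  by rewrite -(pair_bigA _ F); apply: eq_bigr => k _; rewrite big_bool.
exists (T * bool)%type, (fun x i k => (k.2 == (h x == f x))%:R * u x i k.1).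
split=> [x y fxy|x]; last first.
  apply: le_trans (u_cost x); apply: ler_sum => i _.
  rewrite (sum_tag (fun k t => ((t == (h x == f x))%:R * u x i k) ^+ 2)).
  apply: ler_sum => k _.
  by case: (h x == f x); rewrite mul1r mul0r expr0n ?addr0 ?add0r.
transitivity ((h x != h y)%:R * query_gram u x y); last first.
  by have [_|/u_eq1 ->] := eqVneq (h x) (h y); rewrite ?mul0r ?mulr1.
rewrite mulr_sumr; apply: eq_bigr => i _.
rewrite (sum_tag (fun k t => (x i != y i)%:R *
  ((t == (h x == f x))%:R * u x i k * ((t == (h y == f y))%:R * u y i k)))).
rewrite mulr_sumr; apply: eq_bigr => k _.
by move: fxy; case: (f x) (f y) (h x) (h y) => [] [] [] [] //= _; ring.
Qed.

Lemma primal_schur_mask A f W G d p i (x : input n) (mask : input n -> bool)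
    (H : input n -> R) :
  primal_cert A f W G d p ->
  (forall y : input n, x i != y i -> H y = (mask y)%:R * G x y) ->
  \sum_(y : input n) (x i != y i)%:R * (H y * p i y) <= p i x.
Proof.
move=> [_ G_ge0 _ _ _ _ _ p_gt0 schur] HE.
apply: le_trans (schur i x); apply: ler_sum => y _.
have [_|xy] := eqVneq (x i) (y i); first by rewrite !mul0r.
rewrite HE // !mul1r -mulrA; case: (mask y); rewrite ?mul1r // mul0r.
by rewrite mulr_ge0 // ltW.
Qed.

Lemma primal_cert_edge A f W G d p x y :
  primal_cert A f W G d p -> G x y != 0 ->
  f y = ~~ f x /\ forall i, i \notin A -> y i = x i.
Proof.
move=> [_ _ Gf GA _ _ _ _ _] Gxy; split.
  by apply: contraNeq Gxy => fxy; rewrite Gf //; case: (f x) (f y) fxy => [] [].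
by move=> i iA; apply: contraNeq Gxy; rewrite eq_sym => xy; rewrite (GA _ _ _ iA xy).
Qed.

End EdgesAndTags.

Section Composition.
Variables (R : realFieldType) (n : nat) (A B : {set 'I_n}) (a b : input n -> bool).
Variables (g : bool -> bool -> bool) (sa sb W : R).
Implicit Types x y : input n.

(* A dual solution of the gate [g] when querying its two bits costs [sa] and [sb]. *)
Definition dual_gate (ua ub : bool -> bool -> R) : Prop :=
  (forall a1 b1 a2 b2, g a1 b1 != g a2 b2 ->
     (a1 != a2)%:R * (ua a1 b1 * ua a2 b2) + (b1 != b2)%:R * (ub a1 b1 * ub a2 b2) = 1) /\
  (forall a1 b1, ua a1 b1 ^+ 2 * sa + ub a1 b1 ^+ 2 * sb <= W).

(* [c] is an eigenvector of the adversary matrix of [g] that has weight [sa] on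
   the flips of the first bit and [sb] on the flips of the second one. *)
Definition primal_gate (c : bool -> bool -> R) : Prop :=
  (forall v, exists a1 b1, g a1 b1 = v /\ c a1 b1 != 0) /\
  (forall a1 b1,
     (g a1 b1 != g (~~ a1) b1)%:R * (c (~~ a1) b1 * sa) +
     (g a1 b1 != g a1 (~~ b1))%:R * (c a1 (~~ b1) * sb) = W * c a1 b1).

Definition certified_gate : Prop :=
  [/\ 0 < W, exists ua ub, dual_gate ua ub & exists c, primal_gate c].

Definition comp_gate x : bool := g (a x) (b x).

Lemma dual_cert_comp ua ub :
  dual_cert a sa -> dual_cert b sb -> dual_gate ua ub -> dual_cert comp_gate W.
Proof.
move=> /(dual_cert_tag comp_gate)[Ta [va [va_eq va_cost]]].
move=> /(dual_cert_tag comp_gate)[Tb [vb [vb_eq vb_cost]]] [u_eq1 u_cost].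
exists (Ta + Tb)%type, (fun x i k => match k with
  | inl ka => ua (a x) (b x) * va x i ka
  | inr kb => ub (a x) (b x) * vb x i kb
  end).
split=> [x y fxy|x].
  rewrite -[RHS](u_eq1 _ _ _ _ fxy) -va_eq // -vb_eq // !mulr_suml -big_split.
  apply: eq_bigr => i _; rewrite big_sumType !mulr_suml /=.
  by congr (_ + _); apply: eq_bigr => k _; ring.
apply: le_trans (u_cost (a x) (b x)).
apply: (@le_trans _ _ (ua (a x) (b x) ^+ 2 * query_cost va x +
    ub (a x) (b x) ^+ 2 * query_cost vb x)); last first.
  by apply: lerD; rewrite ler_wpM2l ?sqr_ge0.
rewrite !mulr_sumr -big_split; apply: ler_sum => i _ /=.
rewrite big_sumType !mulr_sumr /=.
by under eq_bigr do rewrite exprMn; under [X in _ + X]eq_bigr do rewrite exprMn.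
Qed.

Section PrimalComposition.
Hypothesis disjAB : [disjoint A & B].
Hypotheses (a_local : depends_only_on A a) (b_local : depends_only_on B b).
Variables (Ga Gb : input n -> input n -> R) (da db : input n -> R).
Variables (pa pb : 'I_n -> input n -> R).
Hypotheses (aP : primal_cert A a sa Ga da pa) (bP : primal_cert B b sb Gb db pb).

Definition comp_matrix x y : R := (comp_gate x != comp_gate y)%:R * (Ga x y + Gb x y).

Definition comp_vec (c : bool -> bool -> R) x : R := c (a x) (b x) * (da x * db x).

Definition comp_schur i : input n -> R := if i \in A then pa i else pb i.

Lemma left_edge x y : Ga x y != 0 -> [/\ a y = ~~ a x, b y = b x & db y = db x].
Proof.
move=> /(primal_cert_edge aP)[aE yA].
have yB i : i \in B -> y i = x i by move=> iB; rewrite yA // (disjointFl disjAB).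
by split; rewrite ?aE ?(b_local yB) ?(primal_vec_local bP yB).
Qed.

Lemma right_edge x y : Gb x y != 0 -> [/\ b y = ~~ b x, a y = a x & da y = da x].
Proof.
move=> /(primal_cert_edge bP)[bE yB].
have yA i : i \in A -> y i = x i by move=> iA; rewrite yB // (disjointFr disjAB).
by split; rewrite ?bE ?(a_local yA) ?(primal_vec_local aP yA).
Qed.

Lemma comp_vec_local c x y : {in A :|: B, x =1 y} -> comp_vec c x = comp_vec c y.
Proof.
move=> xy; have xyA i : i \in A -> x i = y i by move=> iA; apply: xy; rewrite inE iA.
have xyB i : i \in B -> x i = y i by move=> iB; apply: xy; rewrite inE iB orbT.
rewrite /comp_vec (a_local xyA) (b_local xyB).
by rewrite (primal_vec_local aP xyA) (primal_vec_local bP xyB).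
Qed.

Lemma comp_vec_neq0 c v : primal_gate c ->
  exists2 x, comp_gate x = v & comp_vec c x != 0.
Proof.
move=> [/(_ v)[a1 [b1 [gab cab]]] _].
have [xa axa dxa] := primal_vec_neq0 aP a1; have [xb bxb dxb] := primal_vec_neq0 bP b1.
pose z : input n := [ffun i => if i \in A then xa i else xb i].
have zA i : i \in A -> z i = xa i by move=> iA; rewrite ffunE iA.
have zB i : i \in B -> z i = xb i by move=> iB; rewrite ffunE (disjointFl disjAB iB).
exists z; first by rewrite /comp_gate (a_local zA) (b_local zB) axa bxb.
rewrite /comp_vec (a_local zA) (b_local zB) axa bxb.
by rewrite (primal_vec_local aP zA) (primal_vec_local bP zB) !mulf_neq0.
Qed.

Lemma comp_eigen c x : primal_gate c ->
  \sum_y comp_matrix x y * comp_vec c y = W * comp_vec c x.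
Proof.
move=> [_ eig]; rewrite /comp_vec [RHS]mulrA -eig mulrDl.
transitivity ((g (a x) (b x) != g (~~ a x) (b x))%:R * c (~~ a x) (b x) * db x *
     (\sum_y Ga x y * da y) +
   (g (a x) (b x) != g (a x) (~~ b x))%:R * c (a x) (~~ b x) * da x *
     (\sum_y Gb x y * db y)); last first.
  by rewrite (primal_eigen aP) (primal_eigen bP); ring.
rewrite !mulr_sumr -big_split; apply: eq_bigr => y _ /=.
rewrite /comp_matrix mulrDr mulrDl; congr (_ + _).
  have [->|/left_edge[aE bE dE]] := eqVneq (Ga x y) 0; first by rewrite !(mulr0, mul0r).
  by rewrite /comp_gate aE bE dE; ring.
have [->|/right_edge[bE aE dE]] := eqVneq (Gb x y) 0; first by rewrite !(mulr0, mul0r).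
by rewrite /comp_gate aE bE dE; ring.
Qed.

Lemma comp_schur_le i x :
  \sum_(y : input n) (x i != y i)%:R * (comp_matrix x y * comp_schur i y) <=
  comp_schur i x.
Proof.
rewrite /comp_schur; case: ifP => iA.
  apply: (primal_schur_mask (mask := fun y => comp_gate x != comp_gate y) aP) => y xy.
  by rewrite /comp_matrix (primal_local bP _ xy) ?(disjointFr disjAB) // addr0.
apply: (primal_schur_mask (mask := fun y => comp_gate x != comp_gate y) bP) => y xy.
by rewrite /comp_matrix (primal_local aP _ xy) ?iA // add0r.
Qed.

Lemma primal_cert_comp c : primal_gate c ->
  primal_cert (A :|: B) comp_gate W comp_matrix (comp_vec c) comp_schur.
Proof.
move=> gc; split=> [x y|x y|x y fxy|x y i|x y|v|x|i x|i x].
- by rewrite /comp_matrix eq_sym (primal_sym aP) (primal_sym bP).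
- by rewrite mulr_ge0 ?addr_ge0 ?(primal_ge0 aP) ?(primal_ge0 bP).
- by rewrite /comp_matrix fxy eqxx mul0r.
- rewrite inE negb_or => /andP[iA iB] xy.
  by rewrite /comp_matrix (primal_local aP iA xy) (primal_local bP iB xy) addr0 mulr0.
- exact: comp_vec_local.
- exact: comp_vec_neq0.
- exact: comp_eigen.
- by rewrite /comp_schur; case: ifP; rewrite ?(primal_schur_gt0 aP) ?(primal_schur_gt0 bP).
- exact: comp_schur_le.
Qed.

End PrimalComposition.

Lemma certified_comp : [disjoint A & B] -> certified_gate ->
  certified A a sa -> certified B b sb -> certified (A :|: B) comp_gate W.
Proof.
move=> dAB [W_gt0 [ua [ub gD]] [c gP]].
move=> [aA _ aD [Ga [da [pa aP]]]] [bB _ bD [Gb [db [pb bP]]]].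
split=> //; last by do 3!eexists; apply: primal_cert_comp aP bP _ gP.
  move=> x y xy; congr g; [apply: aA|apply: bB] => i iC;
    by apply: xy; rewrite inE iC ?orbT.
exact: dual_cert_comp gD.
Qed.

End Composition.

Section Gates.
Variable R : rcfType.
Implicit Types s t : R.

Lemma certified_gate_and s t : 0 < s -> 0 < t ->
  certified_gate andb s t (Num.sqrt (s ^+ 2 + t ^+ 2)).
Proof.
move=> s_gt0 t_gt0; set w := Num.sqrt _.
have w_gt0 : 0 < w by rewrite sqrtr_gt0 ltr_pwDl ?exprn_gt0 ?sqr_ge0.
have w2 : w ^+ 2 = s ^+ 2 + t ^+ 2 by rewrite sqr_sqrtr // addr_ge0 ?sqr_ge0.
have [sN tN wN] : [/\ s != 0, t != 0 & w != 0] by rewrite !gt_eqF.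
have wE : s / w * s + t / w * t = w by rewrite -[RHS](mulfK wN) -expr2 w2; field.
split=> //; last first.
  exists (fun a b => if a then (if b then 1 else t / w) else (if b then s / w else 0)).
  split; first case.
  - by exists true, true; rewrite oner_neq0.
  - by exists true, false; rewrite /= mulf_neq0 ?invr_eq0.
  by case=> [] [] /=; [rewrite -[in RHS]wE; ring|field|field|ring].
pose q := Num.sqrt (s / w); pose r := Num.sqrt (t / w).
have q2 : q ^+ 2 = s / w by rewrite sqr_sqrtr ?divr_ge0 ?ltW.
have r2 : r ^+ 2 = t / w by rewrite sqr_sqrtr ?divr_ge0 ?ltW.
have [qN rN] : q != 0 /\ r != 0 by rewrite !gt_eqF ?sqrtr_gt0 ?divr_gt0.
exists (fun a b => if a then (if b then q else 0) else q^-1),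
  (fun a b => if a then (if b then r else r^-1) else 0); split.
  by case=> [] [] [] [] //= _; rewrite ?mulfV ?mulVf //; ring.
have [qs rt] : q^-1 ^+ 2 * s = w /\ r^-1 ^+ 2 * t = w.
  by rewrite !exprVn q2 r2 !invf_div !divfK.
by case=> [] [] /=; rewrite ?q2 ?r2 ?wE ?qs ?rt ?expr0n ?mul0r ?addr0 ?add0r.
Qed.

Lemma certified_gate_xor s t : 0 < s -> 0 < t -> certified_gate addb s t (s + t).
Proof.
move=> s_gt0 t_gt0; split; first exact: addr_gt0.
- exists (fun _ _ => 1), (fun _ _ => 1); split=> [|a b]; last by rewrite expr1n !mul1r.
  by case=> [] [] [] [] //= _; ring.
exists (fun _ _ => 1); split; last by case=> [] [] /=; ring.
by case; [exists true, false|exists true, true]; rewrite oner_neq0.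
Qed.

End Gates.

(** * Read-once formulas *)

Lemma disjoint_bigcup_seq (I : eqType) (T : finType) (s t : seq I) (A : I -> {set T}) :
  {in s & t, forall r r', [disjoint A r & A r']} ->
  [disjoint \bigcup_(r <- s) A r & \bigcup_(r <- t) A r].
Proof.
move=> dA; rewrite -finset.setI_eq0 big_distrlr /=.
rewrite big_seq big1 // => r rs; rewrite big_seq big1 // => r' rt.
exact: disjoint_setI0 (dA _ _ rs rt).
Qed.

Lemma feval_ext (g : formula) (y z : nat -> bool) :
  {in fleaves g, y =1 z} -> feval g y = feval g z.
Proof.
have sub (s t : seq nat) : {in s ++ t, y =1 z} -> {in s, y =1 z} /\ {in t, y =1 z}.
  by move=> yz; split=> r rs; apply: yz; rewrite mem_cat rs ?orbT.
elim: g => [r|g IH|g IHg h IHh|g IHg h IHh|g IHg h IHh] /=.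
- by apply; rewrite inE.
- by move=> /IH ->.
all: by move=> /sub[/IHg -> /IHh ->].
Qed.

Section ReadOnceFormulas.
Variables (R : rcfType) (n : nat).
Implicit Types (A B : {set 'I_n}) (f a b : input n -> bool).

(* Constant functions have no adversary matrix, hence no certificate. *)
Definition const_or_certified A f : Prop :=
  (exists c, f =1 fun=> c) \/ exists W : R, certified A f W.

Lemma eq_const_or_certified A f g :
  f =1 g -> const_or_certified A f -> const_or_certified A g.
Proof. by move=> /funext ->. Qed.

Lemma const_or_certified_sub A B f :
  A \subset B -> const_or_certified A f -> const_or_certified B f.
Proof. by move=> AB [|[W fW]]; [left|right; exists W; apply: certified_sub fW]. Qed.

Lemma const_or_certified_not A f :
  const_or_certified A f -> const_or_certified A (fun x => ~~ f x).
Proof.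
move=> [[c fc]|[W fW]]; first by left; exists (~~ c) => x; rewrite fc.
by right; exists W; apply: certified_not.
Qed.

Lemma const_or_certified_and A B a b : [disjoint A & B] ->
  const_or_certified A a -> const_or_certified B b ->
  const_or_certified (A :|: B) (fun x => a x && b x).
Proof.
move=> dAB [[[] ac]|[s sA]].
- move/(const_or_certified_sub (finset.subsetUr A B)).
  by apply: eq_const_or_certified => x; rewrite ac.
- by left; exists false => x; rewrite ac.
move=> [[[] bc]|[t tB]].
- apply: eq_const_or_certified (const_or_certified_sub (finset.subsetUl A B) _).
    by move=> x; rewrite bc andbT.
  by right; exists s.
- by left; exists false => x; rewrite bc andbF.
have [[_ s_gt0 _ _] [_ t_gt0 _ _]] := (sA, tB).
by right; eexists; apply: certified_comp dAB (certified_gate_and s_gt0 t_gt0) sA tB.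
Qed.

Lemma const_or_certified_or A B a b : [disjoint A & B] ->
  const_or_certified A a -> const_or_certified B b ->
  const_or_certified (A :|: B) (fun x => a x || b x).
Proof.
move=> dAB /const_or_certified_not ta /const_or_certified_not tb.
have := const_or_certified_not (const_or_certified_and dAB ta tb).
apply: eq_const_or_certified => x.
by rewrite negb_and !negbK.
Qed.

Lemma const_or_certified_xor A B a b : [disjoint A & B] ->
  const_or_certified A a -> const_or_certified B b ->
  const_or_certified (A :|: B) (fun x => a x (+) b x).
Proof.
have addc c D f : const_or_certified D f -> const_or_certified D (fun x => f x (+) c).
  case: c => [/const_or_certified_not|]; apply: eq_const_or_certified => x.
    by rewrite addbT.
  by rewrite addbF.
move=> dAB [[c ac]|[s sA]].
  move/(const_or_certified_sub (finset.subsetUr A B))/(addc c).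
  by apply: eq_const_or_certified => x; rewrite ac addbC.
move=> [[c bc]|[t tB]].
  have a_cert : const_or_certified A a by right; exists s.
  move: (addc c _ _ (const_or_certified_sub (finset.subsetUl A B) a_cert)).
  by apply: eq_const_or_certified => x; rewrite bc.
have [[_ s_gt0 _ _] [_ t_gt0 _ _]] := (sA, tB).
by right; eexists; apply: certified_comp dAB (certified_gate_xor s_gt0 t_gt0) sA tB.
Qed.

Lemma const_or_certified_feval (D : {pred nat}) (A : nat -> {set 'I_n})
    (h : nat -> input n -> bool) (g : formula) :
  {in D, forall r, const_or_certified (A r) (h r)} ->
  {in D &, forall r r', r != r' -> [disjoint A r & A r']} ->
  uniq (fleaves g) -> {subset fleaves g <= D} ->
  const_or_certified (\bigcup_(r <- fleaves g) A r) (fun x => feval g (fun r => h r x)).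
Proof.
move=> hA dA; have split_cat (s t : seq nat) : uniq (s ++ t) -> {subset s ++ t <= D} ->
    [/\ uniq s, uniq t, {subset s <= D}, {subset t <= D}
      & [disjoint \bigcup_(r <- s) A r & \bigcup_(r <- t) A r]].
  rewrite cat_uniq => /and3P[us /hasPn st ut] sD.
  have ls : {subset s <= D} by move=> r rs; apply: sD; rewrite mem_cat rs.
  have lt : {subset t <= D} by move=> r rt; apply: sD; rewrite mem_cat rt orbT.
  split=> //; apply: disjoint_bigcup_seq => r r' rs rt.
  apply: dA (ls _ rs) (lt _ rt) _; apply: contraNneq (st _ rt) => <-.
  exact: rs.
elim: g => [r|g IH|g IHg k IHk|g IHg k IHk|g IHg k IHk] /=.
- by move=> _ rD; rewrite big_seq1; apply: hA; apply: rD; rewrite inE.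
- by move=> ug gD; apply: const_or_certified_not (IH ug gD).
all: move=> u /(split_cat _ _ u)[ug uk gD kD dgk]; rewrite big_cat /=.
- by apply: const_or_certified_and dgk (IHg ug gD) (IHk uk kD).
- by apply: const_or_certified_or dgk (IHg ug gD) (IHk uk kD).
- by apply: const_or_certified_xor dgk (IHg ug gD) (IHk uk kD).
Qed.

End ReadOnceFormulas.

(** * Equality gates *)

Section ConstantInputs.
Variable n : nat.
Hypothesis n_ge3 : (3 <= n)%N.
Implicit Types (x y : input n) (b c : bool) (i j : 'I_n).

Let i0 : 'I_n := Ordinal (leq_trans (isT : 0 < 3)%N n_ge3).

Definition all_equal x : bool := [forall i, forall j, x i == x j].
Definition const_input b : input n := [ffun=> b].
Definition near_const b i : input n := [ffun j => b (+) (j == i)].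

Lemma exists_third i j : exists2 l, l != i & l != j.
Proof.
have /set0Pn[l] : ~: [set i; j] != finset.set0.
  rewrite -card_gt0 cardsCs finset.setCK card_ord subn_gt0 cards2.
  by apply: leq_trans n_ge3; rewrite !ltnS leq_b1.
by rewrite !inE negb_or => /andP[]; exists l.
Qed.

Lemma all_equalP x : reflect (exists b, x = const_input b) (all_equal x).
Proof.
apply: (iffP forallP) => [xE|[b ->] i]; last by apply/forallP => j; rewrite !ffunE.
exists (x i0); apply/ffunP => i; rewrite ffunE.
exact/eqP/(forallP (xE i)).
Qed.

Lemma all_equal_const b : all_equal (const_input b).
Proof. by apply/all_equalP; exists b. Qed.

Lemma const_input_eq b c : (const_input b == const_input c) = (b == c).
Proof.
apply/eqP/eqP => [/ffunP/(_ i0)|-> //].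
by rewrite !ffunE.
Qed.

Lemma near_const_neq b c i : (near_const c i == const_input b) = false.
Proof.
apply/eqP => /ffunP xE; have [l /negbTE li _] := exists_third i i.
by have := xE i; have := xE l; rewrite !ffunE li eqxx addbF addbT => ->; case: b {xE}.
Qed.

Lemma all_equal_near b i : all_equal (near_const b i) = false.
Proof. by apply/all_equalP => -[c /eqP]; rewrite near_const_neq. Qed.

Lemma near_const_eq b c i j :
  (near_const b i == near_const c j) = (b == c) && (i == j).
Proof.
apply/eqP/andP => [/ffunP xE|[/eqP -> /eqP ->] //].
have [l /negbTE li /negbTE lj] := exists_third i j.
have := xE i; have := xE l; rewrite !ffunE li lj !addbF eqxx => ->.
by move=> /addbI <-.
Qed.

Lemma sum_by_value (R : pzRingType) x (F : bool -> R) :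
  \sum_i F (x i) = \sum_b #|[set i | x i == b]|%:R * F b.
Proof.
rewrite (partition_big x predT) //=; apply: eq_bigr => b _.
rewrite (eq_bigr (fun=> F b)) => [|i /eqP -> //].
by rewrite sumr_const mulr_natl; congr (_ *+ _); apply: eq_card => i; rewrite inE.
Qed.

Lemma card_value_gt0 b x : ~~ all_equal x -> (0 < #|[set i | x i == b]|)%N.
Proof.
apply: contraR; rewrite -eqn0Ngt cards_eq0 => /eqP/finset.setP x0.
apply/all_equalP; exists (~~ b); apply/ffunP => i; rewrite ffunE.
by have := x0 i; rewrite !inE; case: (x i) b {x0} => [] [].
Qed.

Lemma card_values x : (\sum_b #|[set i | x i == b]| = n)%N.
Proof.
rewrite big_bool -[RHS]card_ord -(cardsC [set i | x i == true]); congr (_ + _)%N.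
by apply: eq_card => i; rewrite !inE; case: (x i).
Qed.

End ConstantInputs.

Section EqualityGate.
Variables (R : rcfType) (n : nat).
Hypothesis n_ge3 : (3 <= n)%N.
Implicit Types (x y : input n) (b c : bool) (i j : 'I_n).

Let k : R := n%:R.
Let r : R := Num.sqrt (k - 1).
Let m : R := Num.sqrt k.

Let k_ge3 : 3 <= k.
Proof. by rewrite /k ler_nat. Qed.

Let k_gt0 : 0 < k.
Proof. by move: k_ge3; lra. Qed.

Let r_gt0 : 0 < r.
Proof. by rewrite sqrtr_gt0; move: k_ge3; lra. Qed.

Let r2 : r ^+ 2 = k - 1.
Proof. by rewrite sqr_sqrtr //; move: k_ge3; lra. Qed.

Let m_gt0 : 0 < m.
Proof. by rewrite sqrtr_gt0. Qed.

Let m2 : m ^+ 2 = k.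
Proof. by rewrite sqr_sqrtr // ltW. Qed.

Let rmN : (r != 0) * (m != 0).
Proof. by rewrite !gt_eqF. Qed.

Lemma unequal_cost_le (a b : R) : 1 <= a -> 1 <= b -> a + b = k ->
  a * (r / a ^+ 2) + b * (r / b ^+ 2) <= k / r.
Proof.
move=> a_ge1 b_ge1 ab; have [a_gt0 b_gt0] : 0 < a /\ 0 < b by split; lra.
have -> : a * (r / a ^+ 2) + b * (r / b ^+ 2) = r * (a + b) / (a * b).
  by field; rewrite !gt_eqF.
rewrite ab ler_pdivrMr ?mulr_gt0 // -ler_pdivrMl ?divr_gt0 //.
have -> : (k / r)^-1 * (r * k) = r ^+ 2 by field; rewrite rmN gt_eqF.
by rewrite r2 -ab; nra.
Qed.

Lemma dual_cert_all_equal : dual_cert (@all_equal n) (k / r).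
Proof.
pose q := Num.sqrt r.
have qN : q != 0 by rewrite gt_eqF // sqrtr_gt0.
have q2 : q ^+ 2 = r by rewrite sqr_sqrtr // ltW.
pose cnt x b : R := #|[set i | x i == b]|%:R.
have cntN x b : ~~ all_equal x -> cnt x b != 0.
  by move=> /(card_value_gt0 n_ge3 b); rewrite pnatr_eq0 lt0n.
exists unit, (fun x i _ => if all_equal x then q^-1 else q / cnt x (x i)).
apply: dual_solution_intro => [x y /(all_equalP n_ge3)[b ->] yN|x].
  rewrite /query_gram all_equal_const // (negbTE yN).
  transitivity (\sum_i (b != y i)%:R * (cnt y (y i))^-1).
    apply: eq_bigr => i _; rewrite (big_pred1 tt) => [|[] //].
    by rewrite ffunE; congr (_ * _); field; rewrite qN cntN.
  rewrite (sum_by_value y (fun c => (b != c)%:R * (cnt y c)^-1)) big_bool.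
  by case: b; rewrite /= mul0r mulr0 ?addr0 ?add0r mul1r mulfV // cntN.
rewrite /query_cost; under eq_bigr => i _ do rewrite (big_pred1 tt) => [|[] //].
case: (boolP (all_equal x)) => [_|xN].
  by rewrite sumr_const card_ord exprVn q2 -[_ *+ _]mulr_natl.
rewrite (sum_by_value x (fun b => (q / cnt x b) ^+ 2)) big_bool /=.
rewrite -/(cnt x true) -/(cnt x false).
rewrite !expr_div_n q2 unequal_cost_le ?ler1n ?card_value_gt0 //.
by rewrite /k -[in RHS](card_values x) big_bool natrD.
Qed.

Let wsame : R := r / m.
Let wdiff : R := (m * r)^-1.
Let weight b c : R := if b == c then wsame else wdiff.

Let wsame_gt0 : 0 < wsame.
Proof. by rewrite divr_gt0. Qed.

Let wdiff_gt0 : 0 < wdiff.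
Proof. by rewrite invr_gt0 mulr_gt0. Qed.

Let weight_sum : wsame + wdiff = m / r.
Proof.
have -> : wsame + wdiff = (r ^+ 2 + 1) / (m * r).
  by rewrite /wsame /wdiff; field; rewrite !rmN.
by rewrite r2 subrK -m2; field; rewrite !rmN.
Qed.

Let weight_sqr_sum : wsame ^+ 2 + (k - 1) * wdiff ^+ 2 = 1.
Proof.
have -> : wsame ^+ 2 + (k - 1) * wdiff ^+ 2 = (r ^+ 2 + (k - 1) / r ^+ 2) / m ^+ 2.
  by rewrite /wsame /wdiff; field; rewrite !rmN.
by rewrite -r2 mulfV ?sqrf_eq0 ?rmN // r2 m2 subrK mulfV // gt_eqF.
Qed.

(* The edges join the constant inputs [b^n] to the inputs that differ from
   [c^n] in one coordinate, with weight [wsame] if [b = c] and [wdiff] otherwise. *)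
Definition equal_matrix x y : R :=
  \sum_(e : bool * bool * 'I_n) weight e.1.1 e.1.2 *
    ((x == const_input n e.1.1)%:R * (y == near_const e.1.2 e.2)%:R +
     (x == near_const e.1.2 e.2)%:R * (y == const_input n e.1.1)%:R).

Definition equal_vec x : R :=
  if all_equal x then 1
  else if [exists c, exists i, x == near_const c i] then m^-1 else 0.

Definition equal_schur i x : R :=
  if all_equal x then 1 else if [exists c, x == near_const c i] then wsame else wdiff.

Lemma sum_edges (F : bool -> bool -> 'I_n -> R) :
  \sum_(e : bool * bool * 'I_n) F e.1.1 e.1.2 e.2 = \sum_b \sum_c \sum_i F b c i.
Proof. by rewrite pair_bigA pair_bigA. Qed.

Lemma sum_equal_matrix x (F : input n -> R) : \sum_y equal_matrix x y * F y =
  \sum_b \sum_c \sum_i weight b c * ((x == const_input n b)%:R * F (near_const c i) +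
                                   (x == near_const c i)%:R * F (const_input n b)).
Proof.
have delta (z : input n) (G : input n -> R) : \sum_y (y == z)%:R * G y = G z.
  by rewrite (bigD1 z) //= eqxx mul1r big1 ?addr0 // => y /negbTE ->; rewrite mul0r.
rewrite -(sum_edges (fun b c i => weight b c *
  ((x == const_input n b)%:R * F (near_const c i) +
   (x == near_const c i)%:R * F (const_input n b)))).
under eq_bigr do rewrite mulr_suml; rewrite exchange_big; apply: eq_bigr => e _ /=.
rewrite -(delta (near_const _ _) F) -(delta (const_input _ _) F).
rewrite !mulr_sumr -big_split mulr_sumr; apply: eq_bigr => y _ /=; ring.
Qed.

Lemma sum_equal_matrix_const b (F : input n -> R) :
  \sum_y equal_matrix (const_input n b) y * F y =
  \sum_i (wsame * F (near_const b i) + wdiff * F (near_const (~~ b) i)).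
Proof.
rewrite sum_equal_matrix.
transitivity (\sum_b' \sum_c \sum_i (b == b')%:R * (weight b' c * F (near_const c i))).
  apply: eq_bigr => b' _; apply: eq_bigr => c _; apply: eq_bigr => i _.
  by rewrite const_input_eq // [_ == near_const _ _]eq_sym near_const_neq //=; ring.
rewrite !big_bool -!big_split; apply: eq_bigr => i _; rewrite /weight.
by case: b => /=; ring.
Qed.

Lemma sum_equal_matrix_near c i (F : input n -> R) :
  \sum_y equal_matrix (near_const c i) y * F y =
  wsame * F (const_input n c) + wdiff * F (const_input n (~~ c)).
Proof.
rewrite sum_equal_matrix.
transitivity (\sum_b \sum_c' \sum_j
    (i == j)%:R * ((c == c')%:R * (weight b c' * F (const_input n b)))).
  apply: eq_bigr => b _; apply: eq_bigr => c' _; apply: eq_bigr => j _.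
  rewrite near_const_neq // near_const_eq //.
  by case: (c == c'); case: (i == j); rewrite /=; ring.
have delta (e : R) : \sum_j (i == j)%:R * e = e.
  rewrite -mulr_suml (bigD1 i) //= eqxx big1 ?addr0 ?mul1r // => j.
  by rewrite eq_sym => /negbTE ->.
rewrite !big_bool !delta /weight.
by case: c => /=; ring.
Qed.

Lemma equal_matrix_sym x y : equal_matrix x y = equal_matrix y x.
Proof. by apply: eq_bigr => e _; rewrite addrC ![(y == _)%:R * _]mulrC. Qed.

Variant equal_spec x : Prop :=
  | EqualConst b of x = const_input n b
  | EqualNear c i of x = near_const c i
  | EqualFar of ~~ all_equal x & (forall c i, (x == near_const c i) = false).

Lemma equalP x : equal_spec x.
Proof.
have [/(all_equalP n_ge3)[b ->]|xN] := boolP (all_equal x); first exact: EqualConst.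
have [/existsP[c /existsP[i /eqP ->]]|no_near] :=
    boolP [exists c, exists i, x == near_const c i]; first exact: EqualNear.
apply: EqualFar => // c i; apply: contraNF no_near => xE.
by apply/existsP; exists c; apply/existsP; exists i.
Qed.

Lemma sum_equal_matrix_far x (F : input n -> R) : ~~ all_equal x ->
  (forall c i, (x == near_const c i) = false) -> \sum_y equal_matrix x y * F y = 0.
Proof.
move=> xN xfar; rewrite sum_equal_matrix.
rewrite big1 // => b _; rewrite big1 // => c _; rewrite big1 // => i _.
have /negbTE -> : x != const_input n b.
  by apply: contra xN => /eqP ->; apply: all_equal_const.
by rewrite xfar /=; ring.
Qed.

Lemma equal_vec_const b : equal_vec (const_input n b) = 1.
Proof. by rewrite /equal_vec all_equal_const. Qed.

Lemma equal_vec_near c i : equal_vec (near_const c i) = m^-1.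
Proof.
rewrite /equal_vec all_equal_near //; case: existsP => // -[].
by exists c; apply/existsP; exists i.
Qed.

Lemma equal_schur_const i b : equal_schur i (const_input n b) = 1.
Proof. by rewrite /equal_schur all_equal_const. Qed.

Lemma equal_schur_near i c j :
  equal_schur i (near_const c j) = if i == j then wsame else wdiff.
Proof.
rewrite /equal_schur all_equal_near //.
have -> : [exists b, near_const c j == near_const b i] = (i == j); last by [].
apply/existsP/eqP => [[b]|->]; last by exists c.
by rewrite near_const_eq // => /andP[_ /eqP].
Qed.

Lemma equal_matrix_eigen x : \sum_y equal_matrix x y * equal_vec y = k / r * equal_vec x.
Proof.
case: (equalP x) => [b ->|c i ->|xN xfar].
- rewrite sum_equal_matrix_const equal_vec_const mulr1.
  under eq_bigr do rewrite !equal_vec_near -mulrDl weight_sum mulrAC mulfV ?rmN //.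
  by rewrite sumr_const card_ord -mulr_natl mul1r.
- rewrite sum_equal_matrix_near !equal_vec_const equal_vec_near !mulr1 weight_sum -m2.
  by field; rewrite !rmN.
rewrite sum_equal_matrix_far // /equal_vec (negbTE xN) ifN ?mulr0 //.
by apply/existsP => -[c /existsP[j]]; rewrite xfar.
Qed.

Lemma equal_matrix_schur i x :
  \sum_(y : input n) (x i != y i)%:R * (equal_matrix x y * equal_schur i y) <=
  equal_schur i x.
Proof.
under eq_bigr do rewrite mulrCA.
case: (equalP x) => [b ->|c j ->|xN xfar].
- rewrite (sum_equal_matrix_const b (fun y => (_ != y i)%:R * equal_schur i y)).
  under eq_bigr do rewrite !equal_schur_near !ffunE.
  rewrite equal_schur_const -[leRHS]weight_sqr_sum (bigD1 i) //= eqxx.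
  rewrite (eq_bigr (fun=> wdiff ^+ 2)) => [|j ji]; last first.
    by rewrite [i == j]eq_sym (negbTE ji); case: (b); rewrite /=; ring.
  rewrite sumr_const cardC1 card_ord -[wdiff ^+ 2 *+ _]mulr_natl -subn1.
  rewrite natrB ?(leq_trans _ n_ge3) //.
  by case: (b); rewrite /= /k; lra.
- rewrite (sum_equal_matrix_near c j (fun y => (_ != y i)%:R * equal_schur i y)).
  rewrite !equal_schur_const equal_schur_near !ffunE.
  by case: (i == j); case: (c); rewrite /= !(mulr0, mulr1, addr0, add0r).
rewrite (sum_equal_matrix_far (fun y => (_ != y i)%:R * equal_schur i y)) //.
by rewrite /equal_schur; do 2?case: ifP => _; rewrite ?ltW.
Qed.

Lemma certified_all_equal :
  certified [set: 'I_n] (@all_equal n) (n%:R / Num.sqrt (n%:R - 1) : R).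
Proof.
split; [|exact: divr_gt0|exact: dual_cert_all_equal|].
  by move=> x y xy; congr all_equal; apply/ffunP => i; apply: xy; rewrite inE.
exists equal_matrix, equal_vec, equal_schur.
split=> [|x y|x y|x y i|x y xy|[]||i x|].
- exact: equal_matrix_sym.
- by apply: sumr_ge0 => e _; rewrite mulr_ge0 ?addr_ge0 ?mulr_ge0 ?ler0n //;
    rewrite /weight; case: ifP; rewrite ltW.
- have mismatch z t b c i : all_equal z = all_equal t ->
      (z == const_input n b)%:R * (t == near_const c i)%:R = 0 :> R.
    rewrite -natrM mulnb; case: andP => // -[/eqP -> /eqP ->].
    by rewrite all_equal_const // all_equal_near.
  move=> xy; apply: big1 => e _.
  by rewrite mismatch // addrC mulrC [_ * (y == _)%:R]mulrC mismatch // addr0 mul0r.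
- by rewrite inE.
- by congr equal_vec; apply/ffunP => i; apply: xy; rewrite inE.
- by exists (const_input n true); rewrite ?all_equal_const // equal_vec_const oner_neq0.
- exists (near_const true (Ordinal (leq_trans (isT : 0 < 3)%N n_ge3))).
    exact: all_equal_near.
  by rewrite equal_vec_near invr_eq0 rmN.
- exact: equal_matrix_eigen.
- by rewrite /equal_schur; do 2?case: ifP.
- exact: equal_matrix_schur.
Qed.

End EqualityGate.

(** * Three-bit gates *)

Local Notation bits3 := (bool * bool * bool)%type.

Definition bit3 (X : bits3) (r : nat) : bool :=
  match r with 0 => X.1.1 | 1 => X.1.2 | _ => X.2 end.
Definition to_bits3 (x : input 3) : bits3 := (x 0, x 1, x 2).
Definition of_bits3 (X : bits3) : input 3 := [ffun i : 'I_3 => bit3 X i].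

Lemma of_bits3K : cancel of_bits3 to_bits3.
Proof. by move=> [[a b] c]; rewrite /to_bits3 !ffunE. Qed.

Lemma bit3_to_bits3 (x : input 3) (i : 'I_3) : bit3 (to_bits3 x) i = x i.
Proof. by case: i => [[|[|[|//]]] lt_i]; congr (x _); apply: val_inj. Qed.

Lemma to_bits3K : cancel to_bits3 of_bits3.
Proof. by move=> x; apply/ffunP => i; rewrite ffunE bit3_to_bits3. Qed.

Lemma sum_ord3 (V : nmodType) (F : 'I_3 -> V) : \sum_i F i = F 0 + F 1 + F 2.
Proof.
rewrite !big_ord_recr big_ord0 /= add0r.
by congr (F _ + F _ + F _); apply: val_inj.
Qed.

Lemma sum_bits3 (V : nmodType) (F : bits3 -> V) : \sum_X F X =
  F (true, true, true) + F (true, true, false) +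
  (F (true, false, true) + F (true, false, false)) +
  (F (false, true, true) + F (false, true, false) +
  (F (false, false, true) + F (false, false, false))).
Proof.
transitivity (\sum_a \sum_b \sum_c F (a, b, c)).
  by rewrite !pair_bigA; apply: eq_bigr => -[[]].
by rewrite !big_bool.
Qed.

Definition dot2 (R : pzRingType) (u v : R * R) : R := u.1 * v.1 + u.2 * v.2.

Definition bitwise_matching (E : rel bits3) : Prop :=
  forall r X Y Z, E X Y -> E X Z ->
    bit3 X r != bit3 Y r -> bit3 X r != bit3 Z r -> Y = Z.

Lemma certified_gate3 (R : realFieldType) (g : bits3 -> bool) (E : rel bits3)
    (d : bits3 -> R) (U0 U1 U2 : bits3 -> R * R) (W : R) :
  0 < W ->
  (forall X Y, g X -> ~~ g Y ->
    (X.1.1 != Y.1.1)%:R * dot2 (U0 X) (U0 Y) + (X.1.2 != Y.1.2)%:R * dot2 (U1 X) (U1 Y) +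
    (X.2 != Y.2)%:R * dot2 (U2 X) (U2 Y) = 1) ->
  (forall X, dot2 (U0 X) (U0 X) + dot2 (U1 X) (U1 X) + dot2 (U2 X) (U2 X) <= W) ->
  symmetric E -> (forall X Y, E X Y -> g X != g Y) -> bitwise_matching E ->
  (forall b, exists2 X, g X = b & d X != 0) ->
  (forall X, \sum_Y (E X Y)%:R * d Y = W * d X) ->
  certified [set: 'I_3] (fun x => g (to_bits3 x)) W.
Proof.
move=> W_gt0 dual cost Esym Eg Em dnz eig.
apply: (@certified_matching _ _ _ (fun x y => E (to_bits3 x) (to_bits3 y))
  (fun x => d (to_bits3 x))) => //.
- exists bool, (fun x i c => let U := nth U2 [:: U0; U1] i in
    if c then (U (to_bits3 x)).1 else (U (to_bits3 x)).2).
  apply: dual_solution_intro => [x y gx gy|x].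
    by rewrite -[RHS](dual _ _ gx gy) /query_gram sum_ord3 !big_bool /= -!mulrDr.
  apply: le_trans (cost (to_bits3 x)).
  by rewrite /query_cost sum_ord3 !big_bool /= /dot2 !expr2.
- by move=> x y /Eg.
- move=> i x y z xy xz xyi xzi; apply: (can_inj to_bits3K).
  by apply: (Em i) xy xz _ _; rewrite !bit3_to_bits3.
- by move=> b; have [X gX dX] := dnz b; exists (of_bits3 X); rewrite of_bits3K.
- move=> x; rewrite -eig [RHS](reindex to_bits3) //.
  by exists of_bits3 => X _; rewrite ?of_bits3K ?to_bits3K.
Qed.

Definition maj3 (X : bits3) : bool := let: (a, b, c) := X in [|| a && b, a && c | b && c].
Definition mux3 (X : bits3) : bool := let: (s, a, b) := X in if s then a else b.
Definition exact2of3 (X : bits3) : bool :=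
  let: (a, b, c) := X in ~~ (a (+) b (+) c) && [|| a, b | c].
Definition nor_and3 (X : bits3) : bool :=
  let: (a, b, c) := X in (~~ a && ~~ b) || [&& a, b & c].
Definition equal3 (X : bits3) : bool := let: (a, b, c) := X in (a == b) && (b == c).

Definition hamming3 (X Y : bits3) : nat :=
  ((X.1.1 != Y.1.1) + (X.1.2 != Y.1.2) + (X.2 != Y.2))%N.

Definition sensitive_edge (g : bits3 -> bool) : rel bits3 :=
  fun X Y => (g X != g Y) && (hamming3 X Y == 1)%N.

Definition mux3_edge : rel bits3 :=
  fun X Y => [&& mux3 X != mux3 Y, X.1.2 != X.2 & Y.1.2 != Y.2].

Definition nor_and3_edge : rel bits3 := fun X Y =>
  let all3 (Z : bits3) := Z == (true, true, true) in
  let in_support (Z : bits3) := (Z.1.1 == Z.1.2) || Z.2 in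
  [&& nor_and3 X != nor_and3 Y, in_support X, in_support Y
    & [|| all3 X, all3 Y | X.2 == Y.2]].

Lemma sensitive_edge_sym g : symmetric (sensitive_edge g).
Proof.
move=> X Y; rewrite /sensitive_edge eq_sym; congr (_ && (_ == _)).
by rewrite /hamming3 [X.1.1 == _]eq_sym [X.1.2 == _]eq_sym [X.2 == _]eq_sym.
Qed.

Lemma sensitive_edge_matching g : bitwise_matching (sensitive_edge g).
Proof.
move=> r X Y Z /andP[_ XY] /andP[_ XZ]; move: r X Y Z XY XZ.
by move=> [|[|r]] [[[] []] []] [[[] []] []] // [[[] []] []].
Qed.

Lemma mux3_edge_matching : bitwise_matching mux3_edge.
Proof.
by move=> [|[|r]] [[[] []] []] [[[] []] []] // [[[] []] []].
Qed.

Lemma nor_and3_edge_matching : bitwise_matching nor_and3_edge.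
Proof.
by move=> [|[|r]] [[[] []] []] [[[] []] []] // [[[] []] []].
Qed.

Section ThreeBitGates.
Variable R : rcfType.

(* [(1, 0)] and [(1/2, h)] are unit vectors at angle 60 degrees. *)
Let h : R := Num.sqrt (3 / 4).

Let h2 : h * h = 3 / 4.
Proof. by rewrite -expr2 sqr_sqrtr //; lra. Qed.

Lemma certified_maj3 : certified [set: 'I_3] (fun x => maj3 (to_bits3 x)) (2 : R).
Proof.
pose V (a b c : bool) : R * R :=
  if b then (if c then (if a then (1/2, h/3) else (0, 0)) else (1, 0))
  else (if c then (1/2, h) else (if a then (0, 0) else (1/2, h/3))).
apply: (@certified_gate3 _ maj3 (sensitive_edge maj3) (fun X => (~~ equal3 X)%:R)
  (fun X => V X.1.1 X.1.2 X.2) (fun X => V X.1.2 X.1.1 X.2)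
  (fun X => V X.2 X.1.1 X.1.2)) => //.
- by move=> [[[] []] []] [[[] []] []] //= _ _; rewrite /dot2 /=; move: h2; lra.
- by move=> [[[] []] []]; rewrite /dot2 /=; move: h2; lra.
- exact: sensitive_edge_sym.
- by move=> X Y /andP[].
- exact: sensitive_edge_matching.
- by case; [exists (true, true, false)|exists (true, false, false)]; rewrite //= oner_neq0.
- by move=> [[[] []] []]; rewrite sum_bits3 /=; lra.
Qed.

Lemma certified_mux3 : certified [set: 'I_3] (fun x => mux3 (to_bits3 x)) (2 : R).
Proof.
apply: (@certified_gate3 _ mux3 mux3_edge (fun X => (X.1.2 != X.2)%:R)
  (fun=> (1, 0)) (fun X => ((X.1.1)%:R, 0)) (fun X => ((~~ X.1.1)%:R, 0))) => //.
- by move=> [[[] []] []] [[[] []] []] //= _ _; rewrite /dot2 /=; lra.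
- by move=> [[[] []] []]; rewrite /dot2 /=; lra.
- by move=> X Y; rewrite /mux3_edge eq_sym [X in _ && X]andbC.
- by move=> X Y /and3P[].
- exact: mux3_edge_matching.
- by case; [exists (true, true, false)|exists (true, false, true)]; rewrite //= oner_neq0.
- by move=> [[[] []] []]; rewrite sum_bits3 /=; lra.
Qed.

Lemma exists_dual_amplitudes (s : R) : 0 < s ->
  exists a b : R, [/\ a * a = s, b * b = s^-1 & a * b = 1].
Proof.
move=> s_gt0; exists (Num.sqrt s), (Num.sqrt s)^-1.
have s2 : Num.sqrt s * Num.sqrt s = s by rewrite -expr2 sqr_sqrtr // ltW.
by rewrite -invfM s2 mulfV // gt_eqF // sqrtr_gt0.
Qed.

Lemma certified_exact2of3 :
  certified [set: 'I_3] (fun x => exact2of3 (to_bits3 x)) (Num.sqrt 7 : R).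
Proof.
set W := Num.sqrt 7; have W_gt0 : 0 < W by rewrite sqrtr_gt0.
have W2 : W * W = 7 by rewrite -expr2 sqr_sqrtr.
have WN : W != 0 by rewrite gt_eqF.
have WV : W^-1 = W / 7 by apply: (mulfI WN); rewrite mulfV // mulrA W2; lra.
have [r [r' [r2 r'2 rr']]] := exists_dual_amplitudes (divr_gt0 (ltr0Sn R 1) W_gt0).
have [s [s' [s2 s'2 ss']]] := exists_dual_amplitudes (divr_gt0 (ltr0Sn R 2) W_gt0).
rewrite !invf_div in r'2 s'2.
have rr'h : r * h * (r' * h) = 3 / 4 by rewrite mulrACA rr' h2 mul1r.
have rrh : r * h * (r * h) = 3 / 2 / W by rewrite mulrACA r2 h2; field.
have r'r'h : r' * h * (r' * h) = 3 / 8 * W by rewrite mulrACA r'2 h2; field.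
pose V (a b c : bool) : R * R :=
  if b then (if c then (if a then s' else s, 0) else (if a then r else r', 0))
  else (if c then (if a then (r / 2, r * h) else (r' / 2, r' * h))
        else (if a then (0, 0) else (r' / 2, r' * h / 3))).
apply: (@certified_gate3 _ exact2of3 (sensitive_edge exact2of3)
  (fun X => if exact2of3 X then 1 else (if equal3 X then 3 * X.1.1%:R else 2) * (W / 7))
  (fun X => V X.1.1 X.1.2 X.2) (fun X => V X.1.2 X.1.1 X.2)
  (fun X => V X.2 X.1.1 X.1.2)) => //.
- by move=> [[[] []] []] [[[] []] []] //= _ _; rewrite /dot2 /=; lra.
- by move=> [[[] []] []]; rewrite /dot2 /=; move: r2 s2 rrh; rewrite WV; lra.
- exact: sensitive_edge_sym.
- by move=> X Y /andP[].
- exact: sensitive_edge_matching.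
- case; first by exists (true, true, false); rewrite //= oner_neq0.
  by exists (true, true, true); rewrite //= gt_eqF //; lra.
- by move=> [[[] []] []]; rewrite sum_bits3 /=; lra.
Qed.

Section NorAndGate.
Variables (v W : R).
Hypotheses (v_root : v * v = 6 * v - 6) (v_gt3 : 3 < v) (W2 : W * W = v) (W_gt0 : 0 < W).

Let vN : (v - 1 != 0) * (v - 2 != 0).
Proof. by rewrite !gt_eqF //; move: v_gt3; lra. Qed.

Definition nor_and3_vec (X : bits3) : R :=
  match X with
  | (true, true, true) => 1
  | (true, true, false) => W / (v - 1)
  | (false, false, false) => (v - 1)^-1
  | (true, false, true) | (false, true, true) => W / (v - 2)
  | (false, false, true) => 2 / (v - 2)
  | _ => 0
  end.

Lemma nor_and3_eigen X :
  \sum_Y (nor_and3_edge X Y)%:R * nor_and3_vec Y = W * nor_and3_vec X.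
Proof.
have eig : W / (v - 1) + 2 * (W / (v - 2)) = W.
  have -> : W / (v - 1) + 2 * (W / (v - 2)) = W * (3 * v - 4) / ((v - 1) * (v - 2)).
    by field; rewrite !vN.
  have -> : (v - 1) * (v - 2) = 3 * v - 4 by move: v_root; lra.
  by rewrite mulfK // gt_eqF //; move: v_gt3; lra.
rewrite sum_bits3; move: X => [[[] []] []];
  rewrite /= ?(mul1r, mul0r, addr0, add0r, mulr0, mulr1) ?[W * (W / _)]mulrA ?W2 //.
- by move: eig; lra.
all: by field; rewrite ?vN.
Qed.

Lemma certified_nor_and3_root :
  certified [set: 'I_3] (fun x => nor_and3 (to_bits3 x)) W.
Proof.
have WN : W != 0 by rewrite gt_eqF.
have vW : v / W = W by rewrite -W2 mulfK.
have [p [p' [p2 p'2 pp']]] := exists_dual_amplitudes (divr_gt0 W_gt0 (ltr0Sn R 1)).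
have [|q [q' [q2 q'2 qq']]] := @exists_dual_amplitudes ((v - 2) / W).
  by rewrite divr_gt0 // subr_gt0; move: v_gt3; lra.
have [|r [r' [r2 r'2 rr']]] := @exists_dual_amplitudes ((v - 1) / W).
  by rewrite divr_gt0 // subr_gt0; move: v_gt3; lra.
rewrite !invf_div in p'2 q'2 r'2.
have {}q2 : q * q = W - 2 / W by rewrite q2 mulrBl vW.
have {}r2 : r * r = W - W^-1 by rewrite r2 mulrBl vW mul1r.
apply: (@certified_gate3 _ nor_and3 nor_and3_edge nor_and3_vec
  (fun X => match X with
     | (true, true, true) => (q', 0) | (true, true, false) => (p' / 2, 0)
     | (true, false, _) => (p', 0) | (false, true, _) => (q, 0)
     | (false, false, _) => (p, 0) end)
  (fun X => match X with
     | (true, true, true) => (q', 0) | (true, true, false) => (p' / 2, 0)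
     | (true, false, _) => (q, 0) | (false, true, _) => (p', 0)
     | (false, false, _) => (p, 0) end)
  (fun X => match X with
     | (true, true, true) => (r', 0) | (true, true, false) => (r, 0)
     | _ => (0, 0) end)) => //.
- by move=> [[[] []] []] [[[] []] []] //= _ _; rewrite /dot2 /=; lra.
- (* At [(1, 1, 1)] the cost is the left-hand side of the eigenvalue equation. *)
  have := nor_and3_eigen (true, true, true); rewrite sum_bits3 /= => eig.
  by move=> [[[] []] []]; rewrite /dot2 /=; lra.
- by move=> [[[] []] []] [[[] []] []].
- by move=> X Y /and4P[].
- exact: nor_and3_edge_matching.
- case; first by exists (true, true, true); rewrite //= oner_neq0.
  by exists (true, true, false); rewrite //= mulf_neq0 ?invr_eq0 ?vN.
- exact: nor_and3_eigen.
Qed.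

End NorAndGate.

Lemma certified_nor_and3 :
  certified [set: 'I_3] (fun x => nor_and3 (to_bits3 x)) (Num.sqrt (3 + Num.sqrt 3) : R).
Proof.
have q2 : Num.sqrt 3 * Num.sqrt 3 = 3 :> R by rewrite -expr2 sqr_sqrtr.
have q_gt0 : 0 < Num.sqrt 3 :> R by rewrite sqrtr_gt0.
apply: (@certified_nor_and3_root (3 + Num.sqrt 3)).
- by move: q2; lra.
- by lra.
- by rewrite -expr2 sqr_sqrtr //; lra.
by rewrite sqrtr_gt0; lra.
Qed.

Lemma certified_equal3 : exists W : R,
  certified [set: 'I_3] (fun x => equal3 (to_bits3 x)) W.
Proof.
eexists; apply: eq_certified (@certified_all_equal R 3 isT) => x.
rewrite /equal3 /=.
apply/(all_equalP (isT : 3 <= 3)%N)/andP => [[b ->]|[/eqP x01 /eqP x12]].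
  by rewrite !ffunE !eqxx.
exists (x 0); apply/ffunP => i; rewrite ffunE -(bit3_to_bits3 x i).
by case: i => [[|[|[|//]]] lt_i] /=; rewrite -?x12 -?x01.
Qed.

End ThreeBitGates.

(** * Classification of the gates on at most three bits *)

(* Up to permuting the bits and negating some of them or the output, these are
   the three-bit functions that are not given by a read-once formula. *)
Inductive core_gate := Majority | Multiplexer | ExactlyTwo | NorAnd | Equality.

Definition core_eval (H : core_gate) : bits3 -> bool :=
  match H with
  | Majority => maj3 | Multiplexer => mux3 | ExactlyTwo => exact2of3
  | NorAnd => nor_and3 | Equality => equal3
  end.

Definition core_gates : seq core_gate :=
  [:: Majority; Multiplexer; ExactlyTwo; NorAnd; Equality].

Definition literals (r : nat) : seq formula := [:: FLeaf r; FNot (FLeaf r)].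

Definition binary_gates (s t : seq formula) : seq formula :=
  flatten [seq [:: FAnd a b; FOr a b; FXor a b] | a <- s, b <- t].

Definition read_once_formulas3 : seq formula :=
  let lits2 r r' := binary_gates (literals r) (literals r') in
  literals 0 ++ literals 1 ++ literals 2 ++ lits2 0 1 ++ lits2 0 2 ++ lits2 1 2 ++
  binary_gates (literals 0) (lits2 1 2) ++ binary_gates (literals 1) (lits2 0 2) ++
  binary_gates (literals 2) (lits2 0 1).

Definition all_bits3 : seq bits3 :=
  [seq (p, c) | p <- [seq (a, b) | a <- [:: true; false], b <- [:: true; false]],
                c <- [:: true; false]].

Definition agree3 (t u : bits3 -> bool) : bool := all (fun X => t X == u X) all_bits3.

Definition truncate3 (k : nat) (X : bits3) : bits3 :=
  (X.1.1 && (0 < k), X.1.2 && (1 < k), X.2 && (2 < k))%N.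

Definition select3 (s : seq nat) (X : bits3) : bits3 :=
  (bit3 X (nth 0 s 0), bit3 X (nth 0 s 1), bit3 X (nth 0 s 2))%N.

Definition xor3 (X Y : bits3) : bits3 := (X.1.1 (+) Y.1.1, X.1.2 (+) Y.1.2, X.2 (+) Y.2).

Definition read_once_table (k : nat) (t : bits3 -> bool) : bool :=
  has (fun g => [&& uniq (fleaves g), all (gtn k) (fleaves g) &
                    agree3 t (fun X => feval g (bit3 X))]) read_once_formulas3.

Definition core_table (t : bits3 -> bool) : bool :=
  has (fun H => has (fun s => has (fun m => has (fun o =>
    agree3 t (fun X => o (+) core_eval H (xor3 m (select3 s X))))
    [:: true; false]) all_bits3) (permutations (iota 0 3))) core_gates.

Definition classified3 (k : nat) (t : bits3 -> bool) : bool :=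
  [|| has (fun c => agree3 t (fun=> c)) [:: true; false], read_once_table k t
    | (k == 3)%N && core_table t].

Lemma agree3P (t u : bits3 -> bool) : reflect (t =1 u) (agree3 t u).
Proof.
apply: (iffP allP) => [tu X|tu X _]; last by rewrite tu.
by apply/eqP/tu; case: X => [[[] []] []].
Qed.

Definition tabulate3 (t : bits3 -> bool) : bits3 -> bool :=
  let: (a, b, c, d) := (t (true, true, true), t (true, true, false),
                        t (true, false, true), t (true, false, false)) in
  let: (e, f, g, h) := (t (false, true, true), t (false, true, false),
                        t (false, false, true), t (false, false, false)) in
  fun X => match X with
  | (true, true, true) => a | (true, true, false) => b
  | (true, false, true) => c | (true, false, false) => d
  | (false, true, true) => e | (false, true, false) => f
  | (false, false, true) => g | (false, false, false) => h
  end.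

Lemma tabulate3E t : tabulate3 t =1 t.
Proof. by move=> [[[] []] []]. Qed.

Lemma classified3_truncate k t :
  (0 < k <= 3)%N -> t =1 t \o truncate3 k -> classified3 k t.
Proof.
move=> k13 tk.
have -> : t = tabulate3 (t \o truncate3 k).
  by apply: funext => X; rewrite tabulate3E -tk.
case: k k13 {tk} => [|[|[|[|]]]] // _; rewrite /tabulate3 /truncate3 /=.
- by case: (t (true, false, false)); case: (t (false, false, false)); vm_compute.
- by case: (t (true, true, false)); case: (t (true, false, false));
    case: (t (false, true, false)); case: (t (false, false, false)); vm_compute.
by case: (t (true, true, true)); case: (t (true, true, false));
  case: (t (true, false, true)); case: (t (true, false, false));
  case: (t (false, true, true)); case: (t (false, true, false));
  case: (t (false, false, true)); case: (t (false, false, false)); vm_compute.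
Qed.

Section SmallGates.
Variables (R : rcfType) (n : nat).
Implicit Types (A : {set 'I_n}) (h : input n -> bool).

Lemma certified_core (H : core_gate) :
  exists W : R, certified [set: 'I_3] (fun x => core_eval H (to_bits3 x)) W.
Proof.
case: H => /=.
- by eexists; apply: certified_maj3.
- by eexists; apply: certified_mux3.
- by eexists; apply: certified_exact2of3.
- by eexists; apply: certified_nor_and3.
- exact: certified_equal3.
Qed.

Section TruthTable.
Variables (A : {set 'I_n}) (h : input n -> bool) (i0 : 'I_n).
Hypotheses (hA : depends_only_on A h) (i0A : i0 \in A) (A_le3 : (#|A| <= 3)%N).

Definition nth_var (r : nat) : 'I_n := nth i0 (enum A) r.

Definition gate_table (X : bits3) : bool := h [ffun i => bit3 X (index i (enum A))].

Definition first_vars (x : input n) : bits3 :=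
  (x (nth_var 0), x (nth_var 1), x (nth_var 2)).

Lemma nth_var_in r : nth_var r \in A.
Proof.
rewrite /nth_var; case: (ltnP r (size (enum A))) => [rA|rA]; last by rewrite nth_default.
by rewrite -mem_enum mem_nth.
Qed.

Lemma nth_var_inj : {in gtn #|A| &, injective nth_var}.
Proof.
move=> r r'; rewrite !inE !cardE => rA r'A /eqP.
by rewrite nth_uniq ?enum_uniq // => /eqP.
Qed.

Lemma bit3_first_vars x r : (r < 3)%N -> bit3 (first_vars x) r = x (nth_var r).
Proof. by case: r => [|[|[|]]]. Qed.

Lemma gate_table_first_vars x : gate_table (first_vars x) = h x.
Proof.
apply: hA => i iA; rewrite ffunE bit3_first_vars.
  by rewrite /nth_var nth_index ?mem_enum.
by apply: leq_trans A_le3; rewrite cardE index_mem mem_enum.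
Qed.

Lemma gate_table_truncate : gate_table =1 gate_table \o truncate3 #|A|.
Proof.
move=> X; apply: hA => i iA; rewrite !ffunE.
have : (index i (enum A) < #|A|)%N by rewrite cardE index_mem mem_enum.
by case: (index _ _) => [|[|r]] lt_r; rewrite /= ?lt_r ?andbT // (leq_trans _ lt_r) ?andbT.
Qed.

Lemma const_or_certified_read_once_table :
  read_once_table #|A| gate_table -> const_or_certified R A h.
Proof.
move=> /(has_nthP (FLeaf 0))[j _ /and3P[ug /allP gA /agree3P tg]].
set g := nth _ _ j in ug gA tg.
have gh (x : input n) : feval g (fun r => x (nth_var r)) = h x.
  rewrite -gate_table_first_vars tg; apply: feval_ext => r /gA rA.
  by rewrite bit3_first_vars // (leq_trans rA).
apply: eq_const_or_certified gh (const_or_certified_sub _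
  (const_or_certified_feval (D := gtn #|A|) (A := fun r => [set nth_var r])
     (h := fun r x => x (nth_var r)) _ _ ug gA)).
- by apply: (big_ind (fun B : {set 'I_n} => B \subset A)) => [|B C BA CA|r _];
    rewrite ?finset.sub0set ?finset.subUset ?BA ?finset.sub1set ?nth_var_in.
- by move=> r _; right; exists 1; apply: certified_var.
- by move=> r r' rA r'A rr'; rewrite disjoints1 inE (inj_in_eq nth_var_inj).
Qed.

Lemma const_or_certified_core_table :
  #|A| = 3%N -> core_table gate_table -> const_or_certified R A h.
Proof.
move=> A3 /(has_nthP Majority)[j _]; set H := nth _ _ j.
move=> /hasP[s]; rewrite mem_permutations => s3 /hasP[m _] /hasP[o _] /agree3P tE.
pose v (j : 'I_3) := nth_var (nth 0%N s j).
have s_lt r : (r < 3)%N -> (nth 0%N s r < 3)%N.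
  move=> r3; have : nth 0%N s r \in s by rewrite mem_nth // (perm_size s3).
  by rewrite (perm_mem s3) mem_iota.
have v_inj : injective v.
  move=> i l /nth_var_inj; rewrite !inE A3 !s_lt // => /(_ isT isT)/eqP.
  by rewrite nth_uniq ?(perm_size s3) ?(perm_uniq s3) // => /eqP/val_inj.
have [W HW] := certified_core H; right; exists W.
apply: certified_sub (eq_certified _ (certified_relabel (of_bits3 m) o v_inj HW)).
  by apply/fintype.subsetP => _ /imsetP[l _ ->]; apply: nth_var_in.
move=> x; rewrite -gate_table_first_vars tE; congr (_ (+) core_eval H _).
by rewrite /to_bits3 /select3 /xor3 /= !bit3_first_vars ?s_lt // !ffunE.
Qed.

Lemma const_or_certified_gate_table : const_or_certified R A h.
Proof.
have A_gt0 : (0 < #|A|)%N by apply/card_gt0P; exists i0.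
have A_small : (0 < #|A| <= 3)%N by rewrite A_gt0.
have := classified3_truncate A_small gate_table_truncate.
case/or3P => [/hasP[c _ /agree3P tc]||/andP[/eqP A3]].
- by left; exists c => x; rewrite -gate_table_first_vars tc.
- exact: const_or_certified_read_once_table.
- exact: const_or_certified_core_table.
Qed.

End TruthTable.

Lemma all_equal_in_enum A (x : input n) :
  [forall i in A, forall j in A, x i == x j] =
  all_equal [ffun r : 'I_#|A| => x (enum_val r)].
Proof.
apply/forall_inP/forallP => [xA r|xE i iA].
  apply/forallP => r'; rewrite !ffunE.
  by have /forall_inP := xA _ (enum_valP r); apply; apply: enum_valP.
apply/forall_inP => j jA.
have /forallP/(_ (enum_rank_in jA j)) := xE (enum_rank_in iA i).
by rewrite !ffunE !enum_rankK_in.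
Qed.

Lemma certified_equal_in A : (3 <= #|A|)%N -> exists W : R,
  certified A (fun x => [forall i in A, forall j in A, x i == x j]) W.
Proof.
move=> A3; have [W AW] : exists W : R, certified [set: 'I_#|A|] (@all_equal #|A|) W.
  by eexists; apply: certified_all_equal.
exists W; apply: eq_certified (certified_sub _
  (certified_relabel [ffun=> false] false (@enum_val_inj _ (mem A)) AW)) => [x|].
  rewrite all_equal_in_enum addFb; congr all_equal.
  by apply/ffunP => r; rewrite !ffunE.
by apply/fintype.subsetP => _ /imsetP[r _ ->]; apply: enum_valP.
Qed.

Lemma const_or_certified_gate_S' K A h : gate_S' K A h -> const_or_certified R A h.
Proof.
move=> [hA [/andP[/card_gt0P[i0 i0A] A3]|[/andP[A2 _] hE]]].
  exact: const_or_certified_gate_table i0A A3.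
have [A3|A3] := leqP #|A| 3.
  have [i0 i0A] : exists i0, i0 \in A by apply/card_gt0P; apply: ltnW.
  exact: const_or_certified_gate_table i0A A3.
have [W AW] := certified_equal_in (ltnW A3); right; exists W.
by apply: eq_certified AW => x; rewrite hE.
Qed.

Lemma const_or_certified_in_S K f : in_S K f -> const_or_certified R [set: 'I_n] f.
Proof.
move=> [l [g [A [h [[ro _] hS dA _ fE]]]]].
apply: eq_const_or_certified (const_or_certified_sub (finset.subsetT _)
  (const_or_certified_feval (D := gtn l) (A := A) (h := h) (g := g) _ _ _ _)) => [x||||].
- by rewrite fE.
- by move=> r rl; apply: const_or_certified_gate_S' (hS r rl).
- exact: dA.
- by rewrite (perm_uniq ro) iota_uniq.
- by move=> r; rewrite (perm_mem ro) mem_iota.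
Qed.

End SmallGates.

Theorem theorem4p8 (R : realType) (K n : nat) (f : {ffun 'I_n -> bool} -> bool) :
  in_S K f ->
  (exists x y, f x != f y) ->
  exists P : spanprog R n,
    (forall x, fP R P x <-> f x) /\
    wsize R P (fun _ _ => 1) = ADV R f.
Proof.
move=> fS [x [y fxy]].
have [[c fc]|[W fW]] := const_or_certified_in_S R fS; first by rewrite !fc eqxx in fxy.
have [y0 fy0] : exists y0, ~~ f y0.
  by case fx: (f x) fxy; [exists y; case: (f y) fxy|exists x; rewrite fx].
have [_ _ [T [u fu]] _] := fW.
have Pf := dual_program_fP fu fy0; exists (dual_program f u y0); split=> //.
apply/eqP; rewrite eq_le ADV_le_wsize // (certified_ADV fW) andbT.
exact: wsize_dual_program_le fu fy0.
Qed.
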